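(* There is an algorithm that, given an instance $I$ of Target Weighted Gerrymandering on an arbitrary graph $G$ with $n=|V(G)|$ and a tie-breaking rule $\eta$, runs in time $2^n|I|^{\mathcal{O}(1)}$ and solves the instance $I$.
   Context: A district is a nonempty $U\subseteq V(G)$ with $G[U]$ connected. A tie-breaking rule $\eta$ assigns to every district $U$ a single winner $\eta(U)\in\arg\max_{q\in\mathcal{C}}\sum_{v\in U}w_v(q)$, where each voter $v$ has weight function $w_v\colon\mathcal{C}\to\mathbb{Z}^+$ over the candidate set $\mathcal{C}$. Target Weighted Gerrymandering: given $G$, $\mathcal{C}$, $\{w_v\}_{v\in V(G)}$, a distinguished candidate $p\in\mathcal{C}$, and positive integers $k,k^\star$, decide whether $V(G)$ can be partitioned into $k$ pairwise disjoint districts such that $p$ wins in exactly $k^\star$ districts and no other candidate wins in more than $k^\star-1$ districts. $|I|$ denotes the size of the instance. *)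

(* Defs.v *)
From HB Require Import structures.
From mathcomp Require Import all_boot.

Set Implicit Arguments.
Unset Strict Implicit.
Unset Printing Implicit Defensive.

(** * Target Weighted Gerrymandering *)

(* Vertices and candidates of an instance are numbered from 0; the set of
   candidates is nonempty because it contains [target]. *)
Record instance := Instance {
  nv : nat;
  nc : nat;
  adj : rel 'I_nv;
  adj_sym : symmetric adj;
  adj_irr : irreflexive adj;
  wt : 'I_nv -> 'I_nc -> nat;
  wt_gt0 : forall v q, 0 < wt v q;
  target : 'I_nc;
  kdist : nat;
  kdist_gt0 : 0 < kdist;
  kstar : nat;
  kstar_gt0 : 0 < kstar
}.

Definition induced_rel (I : instance) (U : {set 'I_(nv I)}) : rel 'I_(nv I) :=
  [rel x y | [&& x \in U, y \in U & adj x y]].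

Definition district (I : instance) (U : {set 'I_(nv I)}) : bool :=
  (U != set0) &&
  [forall x in U, forall y in U, connect (induced_rel U) x y].

Definition score (I : instance) (U : {set 'I_(nv I)}) (q : 'I_(nc I)) : nat :=
  \sum_(v in U) wt v q.

(* The values of [eta] on sets that are not districts are unconstrained. *)
Definition tie_breaking_rule (I : instance)
    (eta : {set 'I_(nv I)} -> 'I_(nc I)) : Prop :=
  forall U, district U -> forall q, score U q <= score U (eta U).

Definition wins (I : instance) (eta : {set 'I_(nv I)} -> 'I_(nc I))
    (P : {set {set 'I_(nv I)}}) (q : 'I_(nc I)) : nat :=
  #|[set U in P | eta U == q]|.

Definition target_WGM (I : instance)
    (eta : {set 'I_(nv I)} -> 'I_(nc I)) : bool :=
  [exists P : {set {set 'I_(nv I)}},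
    [&& partition P [set: 'I_(nv I)],
        #|P| == kdist I,
        [forall U in P, district U],
        wins eta P (target I) == kstar I &
        [forall q, (q != target I) ==> (wins eta P q <= (kstar I).-1)]]].

(** * Random access machines with logarithmic cost *)

Definition bitlen (x : nat) : nat := (trunc_log 2 x).+1.

(* Subtraction is truncated, and x / 0 = 0. *)
Inductive binop := Add | Sub | Mul | Div.

(* [Cell e] is the content of the memory cell with address [e], so that nested
   cells give indirect addressing; [Input e] is entry number [e] of the
   read-only input; [Query e] is the answer of the oracle to the query [e]. *)
Inductive expr :=
| Const of nat
| Cell of expr
| Input of expr
| Query of expr
| Bin of binop & expr & expr.

(* Structured control flow; a condition holds iff its value is nonzero. *)
Inductive prog :=
| Skip
| Store of expr & expr
| Seq of prog & prog
| If of expr & prog & prog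
| While of expr & prog.

Definition memory := nat -> nat.

Definition update (s : memory) (a x : nat) : memory :=
  fun b => if b == a then x else s b.

Definition binop_val (o : binop) (x y : nat) : nat :=
  match o with
  | Add => x + y
  | Sub => x - y
  | Mul => x * y
  | Div => x %/ y
  end.

(* Multiplication and division are charged as by the schoolbook methods. *)
Definition binop_cost (o : binop) (x y : nat) : nat :=
  match o with
  | Add | Sub => bitlen x + bitlen y
  | Mul | Div => bitlen x * bitlen y
  end.

Fixpoint eval (inp : seq nat) (orc : nat -> nat) (s : memory) (e : expr) : nat :=
  match e with
  | Const x => x
  | Cell e1 => s (eval inp orc s e1)
  | Input e1 => nth 0 inp (eval inp orc s e1)
  | Query e1 => orc (eval inp orc s e1)
  | Bin o e1 e2 => binop_val o (eval inp orc s e1) (eval inp orc s e2)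
  end.

Fixpoint cost (inp : seq nat) (orc : nat -> nat) (s : memory) (e : expr) : nat :=
  match e with
  | Const x => bitlen x
  | Cell e1 | Input e1 | Query e1 =>
      cost inp orc s e1 + bitlen (eval inp orc s e1) + bitlen (eval inp orc s e)
  | Bin o e1 e2 =>
      cost inp orc s e1 + cost inp orc s e2
      + binop_cost o (eval inp orc s e1) (eval inp orc s e2)
  end.

(* [exec inp orc c s t s']: started in memory [s], the program [c] halts in
   memory [s'] after time [t]. *)
Inductive exec (inp : seq nat) (orc : nat -> nat) :
    prog -> memory -> nat -> memory -> Prop :=
| ExecSkip s : exec inp orc Skip s 1 s
| ExecStore a e s :
    exec inp orc (Store a e) s
      (cost inp orc s a + cost inp orc s e
       + bitlen (eval inp orc s a) + bitlen (eval inp orc s e))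
      (update s (eval inp orc s a) (eval inp orc s e))
| ExecSeq c1 c2 s t1 s1 t2 s2 :
    exec inp orc c1 s t1 s1 -> exec inp orc c2 s1 t2 s2 ->
    exec inp orc (Seq c1 c2) s (t1 + t2) s2
| ExecIfT e c1 c2 s t s' :
    eval inp orc s e != 0 -> exec inp orc c1 s t s' ->
    exec inp orc (If e c1 c2) s (cost inp orc s e + bitlen (eval inp orc s e) + t) s'
| ExecIfF e c1 c2 s t s' :
    eval inp orc s e = 0 -> exec inp orc c2 s t s' ->
    exec inp orc (If e c1 c2) s (cost inp orc s e + bitlen (eval inp orc s e) + t) s'
| ExecWhileT e c s t1 s1 t2 s2 :
    eval inp orc s e != 0 ->
    exec inp orc c s t1 s1 -> exec inp orc (While e c) s1 t2 s2 ->
    exec inp orc (While e c) s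
      (cost inp orc s e + bitlen (eval inp orc s e) + t1 + t2) s2
| ExecWhileF e c s :
    eval inp orc s e = 0 ->
    exec inp orc (While e c) s (cost inp orc s e + bitlen (eval inp orc s e)) s.

Lemma exec_det inp orc c s t1 s1 t2 s2 :
  exec inp orc c s t1 s1 -> exec inp orc c s t2 s2 -> t1 = t2 /\ s1 = s2.
Proof.
move=> ex1; elim: ex1 t2 s2 => {c s t1 s1};
  intros; match goal with H : exec _ _ _ _ ?t ?s |- _ = ?t /\ _ = ?s =>
    inversion H; subst end;
  repeat match goal with
  | H : is_true (?x != 0), H' : ?x = 0 |- _ => by rewrite H' in H
  | IH : forall t s, exec _ _ ?c ?m t s -> _ , H : exec _ _ ?c ?m _ _ |- _ =>
      case: (IH _ _ H) => ? ?; clear IH; subst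
  end; by [].
Qed.

(** * Instances as inputs *)

(* Header, adjacency matrix and weights, the last two in row-major order. *)
Definition encode (I : instance) : seq nat :=
  [:: nv I; nc I; val (target I); kdist I; kstar I]
  ++ [seq nat_of_bool (adj u v) | u <- enum 'I_(nv I), v <- enum 'I_(nv I)]
  ++ [seq wt v q | v <- enum 'I_(nv I), q <- enum 'I_(nc I)].

(* The size of an instance is the number of bits of its encoding. *)
Definition instance_size (I : instance) : nat :=
  sumn [seq bitlen x | x <- encode I].

(* The set of vertices whose bits are set in the binary expansion of [x]. *)
Definition set_of_mask (n x : nat) : {set 'I_n} :=
  [set v : 'I_n | odd (x %/ 2 ^ v)].

Definition eta_oracle (I : instance)
    (eta : {set 'I_(nv I)} -> 'I_(nc I)) (x : nat) : nat :=
  eta (set_of_mask (nv I) x).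

(* The machine starts with an all-zero memory and leaves its answer, 1 for yes
   and 0 for no, in cell 0. *)
Definition solves_within (c : prog) (I : instance)
    (eta : {set 'I_(nv I)} -> 'I_(nc I)) (time : nat) : Prop :=
  exists t s,
    [/\ exec (encode I) (eta_oracle eta) c (fun=> 0) t s,
        s 0 = nat_of_bool (target_WGM eta) & t <= time].

(* Main.v *)
Require Import Defs.
From mathcomp Require Import all_boot zify.

Set Implicit Arguments.
Unset Strict Implicit.
Unset Printing Implicit Defensive.

(** Give a district U the weight Y^(1 + D|U|), where Y = 2^b is larger than the
    number of families to be considered and D is larger than the number of
    districts in a family and than k.  For a vertex set X and a candidate q let
    F_q(X) be the total weight of the districts inside X won by q.  These
    values come from a fast zeta transform.  Then
      F_p(X)^kstar * prod_(q <> p) (1 + F_q(X) + ... + F_q(X)^(kstar - 1))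
    is the total weight of the admissible families of districts inside X, and
    its alternating sum over X keeps only the families that cover V(G).  The
    digit of index k + n D in base Y counts those with k districts of total
    size n; as the members are nonempty and cover n vertices, these are the
    partitions that are sought.

    Every table entry is computed once, by one expression, from earlier entries,
    so the running time is the number of entries times a polynomial in the
    number of bits of the largest value ever stored. *)

(** * Running time of table-filling loops *)

Lemma bitlen_leq x j : 0 < j -> (bitlen x <= j) = (x < 2 ^ j).
Proof.
case: j => // j _; rewrite /bitlen ltnS.
case: (posnP x) => [-> | x_gt0]; first by rewrite trunc_log0 expn_gt0.
apply/idP/idP => [lej | ltx].
  have [_ /leq_trans->//] := andP (trunc_log_bounds (isT : 1 < 2) x_gt0).
  by rewrite leq_exp2l.
rewrite -ltnS -(ltn_exp2l _ _ (isT : 1 < 2)).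
by apply: leq_ltn_trans ltx; have [] := andP (trunc_log_bounds (isT : 1 < 2) x_gt0).
Qed.

Lemma ltn_bitlen x : x < 2 ^ bitlen x.
Proof. by rewrite -bitlen_leq. Qed.

Lemma leq_bitlen x y : x <= y -> bitlen x <= bitlen y.
Proof. by move=> le_xy; rewrite bitlen_leq // (leq_ltn_trans le_xy) ?ltn_bitlen. Qed.

Lemma bitlenD x y : bitlen (x + y) <= bitlen x + bitlen y.
Proof.
rewrite bitlen_leq ?addn_gt0 // expnD.
have := ltn_bitlen x; have := ltn_bitlen y.
have: 2 <= 2 ^ bitlen x by rewrite -{1}(expn1 2) leq_exp2l.
have: 2 <= 2 ^ bitlen y by rewrite -{1}(expn1 2) leq_exp2l.
nia.
Qed.

Lemma bitlenM x y : bitlen (x * y) <= bitlen x + bitlen y.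
Proof.
rewrite bitlen_leq ?addn_gt0 // expnD.
have := ltn_bitlen x; have := ltn_bitlen y; nia.
Qed.

(** Chosen so that [esize e * B] bounds the bit length of every value of [e] once inputs, oracle
    answers and memory cells have at most [B] bits. It depends on the expression alone, hence is a
    constant for a fixed program. *)
Fixpoint esize (e : expr) : nat :=
  match e with
  | Const x => bitlen x
  | Cell e1 | Input e1 | Query e1 => (esize e1).+1
  | Bin _ e1 e2 => (esize e1 + esize e2).+1
  end.

Section Machine.

Variables (inp : seq nat) (orc : nat -> nat) (B : nat).
Hypothesis B_gt0 : 0 < B.
Hypothesis inp_le : forall x, bitlen (nth 0 inp x) <= B.
Hypothesis orc_le : forall x, bitlen (orc x) <= B.

Definition bounded (s : memory) := forall a, bitlen (s a) <= B.

Lemma bitlen_eval s e : bounded s -> bitlen (eval inp orc s e) <= esize e * B.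
Proof.
move=> bs; elim: e => [x|e IH|e IH|e IH|o e1 IH1 e2 IH2] /=;
  rewrite ?mulSn.
- exact: leq_pmulr.
- by rewrite (leq_trans (bs _)) ?leq_addr.
- by rewrite (leq_trans (inp_le _)) ?leq_addr.
- by rewrite (leq_trans (orc_le _)) ?leq_addr.
have lb: bitlen (eval inp orc s e1) + bitlen (eval inp orc s e2)
    <= B + (esize e1 + esize e2) * B.
  by rewrite mulnDl (leq_trans (leq_add IH1 IH2)) ?leq_addl.
apply: leq_trans lb; case: o => /=.
- exact: bitlenD.
- by rewrite (leq_trans (leq_bitlen (leq_subr _ _))) ?leq_addr.
- exact: bitlenM.
- by rewrite (leq_trans (leq_bitlen (leq_div _ _))) ?leq_addr.
Qed.

(** The bound is quadratic because of schoolbook multiplication. When two operands are combined, the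
    cross term of the square pays for the product of their bit lengths. *)
Lemma cost_leq s e : bounded s -> cost inp orc s e <= 3 * (esize e * B) ^ 2.
Proof.
move=> bs.
have unary z y : bitlen y <= B -> cost inp orc s z <= 3 * (esize z * B) ^ 2 ->
    cost inp orc s z + bitlen (eval inp orc s z) + bitlen y
    <= 3 * ((esize z).+1 * B) ^ 2.
  move=> yB cz; have := bitlen_eval z bs; rewrite (mulSn (esize z)); nia.
elim: e => [x|e IH|e IH|e IH|o e1 IH1 e2 IH2] /=; try exact: unary.
  have := leq_pmulr (bitlen x) B_gt0; nia.
have := bitlen_eval e1 bs; have := bitlen_eval e2 bs.
set x := eval _ _ _ e1; set y := eval _ _ _ e2 => hy hx.
have: binop_cost o x y <= (esize e1 * B) * (esize e2 * B) + (esize e1 * B) + (esize e2 * B).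
  case: o => /=; nia.
rewrite (mulSn (_ + _)) mulnDl.
move: (binop_cost _ _ _) (cost _ _ _ e1) (cost _ _ _ e2) IH1 IH2.
have : esize e1 * B <= B * (esize e1 * B) by rewrite leq_pmull.
have : esize e2 * B <= B * (esize e2 * B) by rewrite leq_pmull.
move: (esize e1 * B) (esize e2 * B) => p q; rewrite !(sqrnD, mulnDr); lia.
Qed.

(** A Hoare triple for total correctness, with a bound on the running time. *)
Definition runs c (P : memory -> Prop) t (Q : memory -> Prop) :=
  forall s, P s -> exists t' s', [/\ exec inp orc c s t' s', Q s' & t' <= t].

Lemma runs_seq c1 c2 P R Q t1 t2 :
  runs c1 P t1 R -> runs c2 R t2 Q -> runs (Seq c1 c2) P (t1 + t2) Q.
Proof.
move=> r1 r2 s /r1[u1 [s1 [e1 /r2[u2 [s2 [e2 q le2]]] le1]]].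
by exists (u1 + u2), s2; split=> //; [apply: ExecSeq e1 e2 | apply: leq_add].
Qed.

Lemma runs_seqM c1 c2 P R Q t1 t2 u :
  runs c1 P (t1 * u) R -> runs c2 R (t2 * u) Q -> runs (Seq c1 c2) P ((t1 + t2) * u) Q.
Proof. by rewrite mulnDl; apply: runs_seq. Qed.

Definition store_cost a e := 8 * (esize a + esize e) ^ 2.

Lemma exec_store a e s : bounded s ->
  exists t, exec inp orc (Store a e) s t
              (update s (eval inp orc s a) (eval inp orc s e))
    /\ t <= store_cost a e * B ^ 2.
Proof.
move=> bs; eexists; split; first exact: ExecStore.
have := bitlen_eval a bs; have := bitlen_eval e bs.
have := cost_leq a bs; have := cost_leq e bs.
rewrite /store_cost -mulnA -expnMn mulnDl.
set x := esize a * B; set y := esize e * B; nia.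
Qed.

Lemma bounded_update s a x : bounded s -> bitlen x <= B -> bounded (update s a x).
Proof. by move=> bs xB b; rewrite /update; case: eqP. Qed.

Definition counter := Cell (Const 8).
(* Entry [e] of table number [t] is in cell [8 * e + t] with [0 < t < 8]; no
   table uses the cells 0 (the answer) and 8 (the loop counter). *)
Definition addr t e := Bin Add (Bin Mul (Const 8) e) (Const t).

Definition fill_body t E :=
  Seq (Store (addr t counter) E) (Store (Const 8) (Bin Add counter (Const 1))).
Definition fill t L E :=
  Seq (Store (Const 8) (Const 0)) (While (Bin Defs.Sub L counter) (fill_body t E)).

Definition fill_cost t L E :=
  store_cost (Const 8) (Const 0)
  + (4 * esize (Bin Defs.Sub L counter) ^ 2
     + store_cost (addr t counter) E
     + store_cost (Const 8) (Bin Add counter (Const 1))).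

Variables (Len : nat -> nat) (Spec : nat -> nat -> nat).

Definition tables_hold j (s : memory) := bounded s /\
  forall t i, 0 < t <= j -> i < Len t -> s (8 * i + t) = Spec t i.

(** Entries are filled in increasing order, so [E] may read smaller entries of its own table as well
    as all earlier tables. The loop bound [L] is evaluated afresh in every round; it keeps its value
    because the earlier tables stay intact. The successor of [Len t] accounts for the final failing
    test. *)
Lemma fillP t L E : 0 < t < 8 ->
    (forall s, tables_hold t.-1 s -> eval inp orc s L = Len t) ->
    (forall s a, tables_hold t.-1 s -> s 8 = a -> a < Len t ->
       (forall i, i < a -> s (8 * i + t) = Spec t i) ->
       eval inp orc s E = Spec t a) ->
    bitlen (Len t) <= B -> (forall a, a < Len t -> bitlen (Spec t a) <= B) ->
  runs (fill t L E) (tables_hold t.-1) (fill_cost t L E * (Len t).+1 * B ^ 2) (tables_hold t).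
Proof.
move=> /andP[t_gt0 t_lt8] HL HE LB SB.
(* Addresses of different tables differ modulo 8, and the counter has residue 0, so writing to table
   [t] or to the counter leaves the smaller tables alone. *)
have ok_upd s a x : tables_hold t.-1 s -> bitlen x <= B ->
    (a = 8 \/ exists i, a = 8 * i + t) -> tables_hold t.-1 (update s a x).
  move=> [bs os] xB aP; split; first exact: bounded_update.
  move=> t' i t'P iL; rewrite /update; case: eqP => [ea|_]; last exact: os.
  by case: aP => [e8 | [j ej]]; lia.
pose while_t k := (4 * esize (Bin Defs.Sub L counter) ^ 2
     + store_cost (addr t counter) E
     + store_cost (Const 8) (Bin Add counter (Const 1))) * k.+1 * B ^ 2.
pose inv a s := [/\ tables_hold t.-1 s, s 8 = a &
  forall i, i < a -> s (8 * i + t) = Spec t i].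
have loop k a : a + k = Len t ->
    runs (While (Bin Defs.Sub L counter) (fill_body t E)) (inv a) (while_t k) (tables_hold t).
  elim: k a => [|k IH] a ak s [os sa si]; have bs := os.1.
    have e0 : eval inp orc s (Bin Defs.Sub L counter) = 0 by rewrite /= HL // sa; lia.
    eexists _, s; split; first exact: ExecWhileF e0.
      split=> // t' i /andP[t'0 t't] iL.
      move: t't; rewrite leq_eqVlt => /orP[/eqP et | lt't].
        by rewrite et in iL *; apply: si; lia.
      by apply: os.2 => //; lia.
    have := cost_leq (Bin Defs.Sub L counter) bs; have := bitlen_eval (Bin Defs.Sub L counter) bs.
    by rewrite /while_t; set z := esize _; move: (store_cost _ _) (store_cost _ _); nia.
  have e1 : eval inp orc s (Bin Defs.Sub L counter) != 0 by rewrite /= HL // sa; lia.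
  have aL : a < Len t by lia.
  have [u1 [x1 le1]] := exec_store (addr t counter) E bs.
  move: x1; rewrite (HE s a) //= sa => x1.
  set s1 := update _ _ _ in x1.
  have os1 : tables_hold t.-1 s1 by apply: ok_upd => //; [apply: SB | right; exists a].
  have [u2 [x2 le2]] := exec_store (Const 8) (Bin Add counter (Const 1)) os1.1.
  have s18 : s1 8 = a by rewrite /s1 /update; case: eqP => // ?; lia.
  move: x2; rewrite /= s18 => x2.
  set s2 := update _ _ _ in x2.
  have os2 : inv (a + 1) s2.
    split.
    - apply: ok_upd => //; last by left.
      by apply: leq_trans LB; apply: leq_bitlen; lia.
    - by rewrite /s2 /update eqxx.
    move=> i; rewrite addn1 ltnS leq_eqVlt => ia.
    rewrite /s2 /s1 /update; case: eqP => [?|_]; first lia.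
    case/orP: ia => [/eqP-> | ia]; first by rewrite eqxx.
    by case: eqP => [?|_]; [lia | apply: si].
  have [|u3 [s3 [x3 os3 le3]]] := IH (a + 1) _ s2 os2; first lia.
  eexists _, s3; split; [exact: (ExecWhileT e1 (ExecSeq x1 x2) x3) | by [] |].
  have := cost_leq (Bin Defs.Sub L counter) bs; have := bitlen_eval (Bin Defs.Sub L counter) bs.
  move: le1 le2 le3; rewrite /while_t.
  set z := esize _; move: (store_cost _ _) (store_cost _ _) => w1 w2.
  move: (cost _ _ _ _) (bitlen _) => v1 v2 h1 h2 h3 h4 h5.
  have: v1 + v2 <= 4 * z ^ 2 * B ^ 2 by nia.
  by rewrite [_ * k.+2]mulnS [(_ + _ * k.+1) * _]mulnDl 2![in X in _ <= X + _]mulnDl; lia.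
move=> s os; have bs := os.1.
have [u1 [x1 le1]] := exec_store (Const 8) (Const 0) bs.
have [|u2 [s2 [x2 os2 le2]]] := loop (Len t) 0 (add0n _) (update s 8 0).
  by rewrite /inv; split=> //; apply: ok_upd => //; left.
exists (u1 + u2), s2; split=> //; first exact: ExecSeq x1 x2.
move: le1 le2; rewrite /while_t /fill_cost.
move: (store_cost _ _) (4 * _ + _ + _) => w1 w2 h1 h2.
have : w1 * B ^ 2 <= w1 * (Len t).+1 * B ^ 2 by rewrite leq_mul2r leq_pmulr ?orbT.
by rewrite !mulnDl; lia.
Qed.

End Machine.

(** * Vertex sets as bit masks, connectivity *)

Lemma mask_sum n x : x < 2 ^ n -> \sum_(i < n) odd (x %/ 2 ^ i) * 2 ^ i = x.
Proof.
elim: n x => [|n IH] x ltx; first by rewrite big_ord0; case: x ltx.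
rewrite big_ord_recl /= divn1 muln1.
have -> : \sum_(i < n) odd (x %/ 2 ^ bump 0 i) * 2 ^ bump 0 i
   = 2 * \sum_(i < n) odd ((x %/ 2) %/ 2 ^ i) * 2 ^ i.
  rewrite big_distrr /=; apply: eq_bigr => i _.
  by rewrite /bump /= add1n expnS divnMA; lia.
rewrite IH; first by rewrite divn2 mul2n odd_double_half.
by rewrite ltn_divLR // -expnSr.
Qed.

Section Masks.

Variable n : nat.
Implicit Types (S : {set 'I_n}) (X : nat).
Local Notation sm := (set_of_mask n).

Lemma mask_set_sum X : X < 2 ^ n -> X = \sum_(i in sm X) 2 ^ i.
Proof.
move=> ltX; rewrite -[LHS](mask_sum ltX) [RHS]big_mkcond /=.
by apply: eq_bigr => i _; rewrite inE; case: odd; rewrite ?mul1n.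
Qed.

Lemma set_of_mask_bij : bijective (fun X : 'I_(2 ^ n) => sm X).
Proof.
apply: inj_card_bij => [X Y eXY|].
  by apply: val_inj; rewrite /= (mask_set_sum (ltn_ord X)) eXY -mask_set_sum.
by rewrite -[#|{: {set _}}|]cardsT -powersetT card_powerset cardsT !card_ord.
Qed.

Lemma sum_set_of_mask (F : {set 'I_n} -> nat) :
  \sum_(X < 2 ^ n) F (sm X) = \sum_S F S.
Proof. by rewrite [RHS](reindex _ (onW_bij _ set_of_mask_bij)). Qed.

Lemma exists_mask S : exists2 X, X < 2 ^ n & sm X = S.
Proof. by have [g _ gK] := set_of_mask_bij; exists (g S) => //; apply: gK. Qed.

(** This is how the machine deletes a vertex: one subtraction, which also moves to a smaller table
    index. *)
Lemma set_of_maskD1 X (v : 'I_n) : X < 2 ^ n -> v \in sm X ->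
  2 ^ v <= X /\ sm (X - 2 ^ v) = sm X :\ v.
Proof.
move=> ltX Xv; have [Y ltY eY] := exists_mask (sm X :\ v).
have -> : X = 2 ^ v + Y.
  rewrite (mask_set_sum ltX) (mask_set_sum ltY) eY (bigD1 v) //=.
  by congr (_ + _); apply: eq_bigl => i; rewrite !inE andbC.
rewrite addKn leq_addr; split=> //.
rewrite eY; congr (_ :\ _).
have [Z ltZ eZ] := exists_mask (sm X); rewrite -eZ; congr sm.
rewrite (mask_set_sum ltZ) (mask_set_sum ltY) eY eZ (bigD1 v) //=.
by congr (_ + _); apply: eq_bigl => i; rewrite !inE andbC.
Qed.

Lemma card_set_of_mask0 : #|sm 0| = 0.
Proof. by apply/eqP; rewrite cards_eq0; apply/eqP/setP=> i; rewrite !inE div0n. Qed.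

(** Halving drops bit 0 and shifts the other bits down; nothing enters at the top because
    [X < 2 ^ n]. *)
Lemma card_set_of_mask X : X < 2 ^ n -> #|sm X| = #|sm (X %/ 2)| + X %% 2.
Proof.
have cE Y : #|sm Y| = \sum_(i < n) odd (Y %/ 2 ^ i).
  rewrite -sum1_card big_mkcond /=; apply: eq_bigr => i _.
  by rewrite inE; case: odd.
rewrite !cE; case: (n) => [|m] ltX.
  by rewrite !big_ord0; case: X ltX.
rewrite big_ord_recl big_ord_recr /= divn1 modn2.
have -> : X %/ 2 %/ 2 ^ m = 0 by rewrite -divnMA -expnS divn_small.
rewrite addn0 addnC; congr (_ + _); apply: eq_bigr => i _.
by rewrite /bump /= add1n expnS divnMA.
Qed.

End Masks.

Section Connectivity.

Variable I : instance.
Implicit Types (U W : {set 'I_(nv I)}).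

Lemma districtP U : reflect (U != set0 /\ {in U &, forall x y, connect (induced_rel U) x y})
  (district U).
Proof.
apply: (iffP andP) => [[U0 /forall_inP cU]|[U0 cU]]; split=> //.
  by move=> x y Ux Uy; have /forall_inP := cU x Ux; apply.
by apply/forall_inP => x Ux; apply/forall_inP => y; apply: cU.
Qed.

Lemma induced_sym U : connect_sym (induced_rel U).
Proof. by apply: sym_connect_sym => x y; rewrite /induced_rel /= (adj_sym x) andbCA. Qed.

Lemma district1 v : district [set v : 'I_(nv I)].
Proof.
apply/districtP; split; first by apply/set0Pn; exists v; rewrite inE.
by move=> x y /set1P-> /set1P->; apply: connect0.
Qed.

Lemma district_setU1 U v u : district U -> u \in U -> adj u v -> district (v |: U).
Proof.
move=> /districtP[_ cU] Uu uv; apply/districtP; split.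
  by apply/set0Pn; exists v; rewrite setU11.
have sub x y : x \in U -> y \in U -> connect (induced_rel (v |: U)) x y.
  move=> Ux Uy; apply: connect_sub (cU x y Ux Uy) => a b /and3P[Ua Ub ab].
  by apply: connect1; rewrite /induced_rel /= !inE Ua Ub ab !orbT.
have cv x : x \in U -> connect (induced_rel (v |: U)) x v.
  move=> Ux; apply: connect_trans (sub x u Ux Uu) _.
  by apply: connect1; rewrite /induced_rel /= !inE Uu uv eqxx orbT.
move=> x y /setU1P[-> | Ux] /setU1P[-> | Uy] //; [|exact: cv|exact: sub].
by rewrite induced_sym cv.
Qed.

(** If no edge led from [W] to the rest of [U], then [W] would be closed under adjacency in the
    subgraph induced by [U], and would contain [y] along with [x]. *)
Lemma district_edge U W x y : district U -> W \subset U -> x \in W -> y \in U -> y \notin W ->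
  exists u v, [/\ u \in W, v \in U, v \notin W & adj u v].
Proof.
move=> /districtP[_ cU] WU Wx Uy nWy.
have /existsP[u /existsP[v /and4P[Wu Uv nWv uv]]] :
    [exists u, exists v, [&& u \in W, v \in U, v \notin W & adj u v]]; last by exists u, v.
apply: contraNT nWy => /existsPn none.
have clW : closed (induced_rel U) [in W].
  apply: (intro_closed (@induced_sym U)) => a b /and3P[Ua Ub ab] Wa.
  have /existsPn/(_ b) := none a; rewrite Ub ab !andbT.
  by move: Wa; rewrite unfold_in => ->; rewrite negbK.
have := closed_connect clW (cU x y (subsetP WU x Wx) Uy).
by rewrite !unfold_in => <-.
Qed.

(** Replaces paths by a recursion on the deletion of one vertex, which a table can follow. The
    vertex to delete is the last one reached when [U] is grown from a single vertex by adding
    neighbours. *)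
Lemma district_recE U : district U =
  (#|U| == 1) || [exists u, exists v, [&& u \in U, v \in U, adj u v & district (U :\ v)]].
Proof.
apply/idP/orP; last first.
  case=> [/cards1P[v ->]|]; first exact: district1.
  case/existsP=> u /existsP[v /and4P[Uu Uv uv dU]].
  rewrite -(setD1K Uv); apply: district_setU1 dU _ (uv).
  by rewrite !inE Uu andbT; apply: contraTneq uv => ->; rewrite adj_irr.
move=> dU; have [/set0Pn[x0 Ux0] _] := districtP _ dU.
case: (eqVneq #|U| 1) => [|cU1]; [by left | right].
have U_gt1 : 1 < #|U| by rewrite ltn_neqAle eq_sym cU1 card_gt0; apply/set0Pn; exists x0.
pose good j := exists W, [/\ W \subset U, district W & #|W| = j.+1].
have grow j : j < #|U| -> good j.
  elim: j => [|j IH] ltj.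
    by exists [set x0]; rewrite district1 cards1 sub1set.
  have [W [WU dW cW]] := IH (ltnW ltj).
  have [/set0Pn[x Wx] _] := districtP _ dW.
  have /subsetPn[y Uy nWy] : ~~ (U \subset W).
    by apply: contraTN ltj => /subset_leq_card; rewrite cW -leqNgt.
  have [u [v [Wu Uv nWv uv]]] := district_edge dU WU Wx Uy nWy.
  exists (v |: W); split; [|exact: district_setU1 dW Wu uv|].
    by rewrite subUset sub1set Uv.
  by rewrite cardsU1 nWv cW.
(* The grown set with all but one vertex of [U]: the edge leaving it ends in the missing vertex. *)
have [|W [WU dW cW]] := grow #|U|.-2; first lia.
have [/set0Pn[x Wx] _] := districtP _ dW.
have /subsetPn[y Uy nWy] : ~~ (U \subset W).
  by apply/negP=> /subset_leq_card; rewrite cW; lia.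
have [u [v [Wu Uv nWv uv]]] := district_edge dU WU Wx Uy nWy.
apply/existsP; exists u; apply/existsP; exists v; rewrite (subsetP WU) // Uv uv /=.
suff -> : U :\ v = W by [].
apply/esym/eqP; rewrite eqEcard; apply/andP; split.
  apply/subsetP=> z Wz; rewrite !inE (subsetP WU) // andbT.
  by apply: contraTneq Wz => ->.
by have := cardsD1 v U; rewrite Uv cW; lia.
Qed.

End Connectivity.

(** * Zeta transform, inclusion-exclusion and digit extraction *)

Section Zeta.

Variable n : nat.
Implicit Types (U S : {set 'I_n}) (f : {set 'I_n} -> nat).

(* [U] is obtained from [S] by deleting vertices smaller than [i]. *)
Definition agree_from i U S := (U \subset S) && ([set j in S | i <= j] \subset U).

Lemma agree_from0 U S : agree_from 0 U S = (U == S).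
Proof.
rewrite /agree_from eqEsubset (_ : [set j in S | 0 <= j] = S) //.
by apply/setP=> j; rewrite inE andbT.
Qed.

Lemma agree_from_full U S : agree_from n U S = (U \subset S).
Proof.
rewrite /agree_from (_ : [set j in S | n <= j] = set0) ?sub0set ?andbT //.
by apply/setP=> j; rewrite !inE leqNgt ltn_ord andbF.
Qed.

(** If [i] is in [S], the sets [U] on the left split according to whether they contain [i]: those
    that do agree with [S] from [i] on, the others with [S :\ i]. If [i] is not in [S], the
    thresholds [i] and [i.+1] impose the same condition. *)
Lemma zeta_step f (i : 'I_n) S :
  \sum_(U | agree_from i.+1 U S) f U
  = \sum_(U | agree_from i U S) f U
    + (i \in S) * \sum_(U | agree_from i U (S :\ i)) f U.
Proof.
have fromS U : i \in S -> agree_from i.+1 U S && (i \in U) = agree_from i U S.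
  move=> Si; rewrite /agree_from -andbA; congr (_ && _).
  apply/andP/subsetP => [[/subsetP sU Ui] j | sU].
    rewrite !inE => /andP[Sj]; rewrite leq_eqVlt => /orP[/eqP/val_inj<- //|ij].
    by apply: sU; rewrite inE Sj.
  by split; [apply/subsetP=> j; rewrite inE => /andP[Sj /ltnW ij] | ];
    apply: sU; rewrite inE ?Sj ?Si ?ij /=.
have fromN U : i \in S -> agree_from i.+1 U S && (i \notin U) = agree_from i U (S :\ i).
  move=> Si; rewrite /agree_from subsetD1 -!andbA; congr (_ && _).
  rewrite andbC; congr (_ && _).
  rewrite (_ : [set j in S | i < j] = [set j in S :\ i | i <= j]) //; apply/setP=> j.
  rewrite !inE.
  by rewrite ltn_neqAle eq_sym; case: (j \in S); rewrite ?andbF ?andbT.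
have same U : i \notin S -> agree_from i.+1 U S = agree_from i U S.
  move=> nSi; rewrite /agree_from; congr (_ && _).
  rewrite (_ : [set j in S | i < j] = [set j in S | i <= j]) //.
  apply/setP=> j; rewrite !inE ltn_neqAle eq_sym; case: (boolP (j \in S)) => //= Sj.
  by rewrite (_ : j != i :> nat) //; apply: contraNneq nSi => /val_inj<-.
case: (boolP (i \in S)) => Si; last by rewrite addn0; apply: eq_bigl => U; apply: same.
rewrite mul1n (bigID (fun U => i \in U)) /=.
by congr (_ + _); apply: eq_bigl => U; [apply: fromS | apply: fromN].
Qed.

End Zeta.

Section Parity.

Variable T : finType.
Implicit Types (X Y : {set T}).

Definition supersets_of_parity c Y := \sum_(X : {set T} | odd #|X| == c) (Y \subset X : nat).

(** Toggling a fixed element outside [Y] is an involution on the supersets of [Y] that reverses the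
    parity of the size. *)
Lemma supersets_parityN Y : Y != setT ->
  supersets_of_parity true Y = supersets_of_parity false Y.
Proof.
rewrite -subTset => /subsetPn[v _ nYv].
pose toggle X := if v \in X then X :\ v else v |: X.
have toggleK : involutive toggle.
  move=> X; rewrite /toggle; case: (boolP (v \in X)) => Xv.
    by rewrite setD11 setD1K.
  by rewrite setU11 setU1K.
rewrite /supersets_of_parity (reindex_inj (inv_inj toggleK)) /=.
apply: eq_big => [X | X _].
  rewrite /toggle; case: (boolP (v \in X)) => Xv.
    by rewrite [in RHS](cardsD1 v) Xv /=; case: odd.
  by rewrite cardsU1 Xv /=; case: odd.
congr nat_of_bool; rewrite /toggle; case: ifP => Xv.
  by rewrite subsetD1 nYv andbT.
apply/idP/idP => [/subsetP sY | sY]; last exact: subset_trans sY (subsetU1 _ _).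
apply/subsetP=> z Yz; have /setU1P[ezv | //] := sY z Yz.
by rewrite -ezv Yz in nYv.
Qed.

Lemma supersets_parityT c : supersets_of_parity c setT = (odd #|T| == c).
Proof.
rewrite /supersets_of_parity big_mkcond (bigD1 setT) //= subxx cardsT big1 ?addn0.
  by case: (_ == c).
by move=> X XT; rewrite subTset (negPf XT); case: ifP.
Qed.

End Parity.

Section Digit.

Variables (A : Type) (P : pred A) (wt : A -> nat) (B : nat).

(** Fewer than [B] powers are added, so no carries occur: lower powers total less than [B ^ e], and
    higher ones are multiples of [B ^ e.+1]. *)
Lemma digit_sum (r : seq A) e : size r < B ->
  ((\sum_(x <- r | P x) B ^ wt x) %/ B ^ e) %% B = count (fun x => P x && (wt x == e)) r.
Proof.
move=> szB; have B_gt0 : 0 < B by apply: leq_trans szB.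
(* [lo] collects the exponents below [e]; each of its terms times [B] is at most [B ^ e], which
   gives the invariant on [lo * B]. *)
have [lo [hi [eq_sum lo_le]]] : exists lo hi,
   \sum_(x <- r | P x) B ^ wt x
     = lo + B ^ e * (count (fun x => P x && (wt x == e)) r + B * hi)
   /\ lo * B <= size r * B ^ e.
  elim: r {szB} => [|x r [lo [hi [IH le_lo]]]].
    by exists 0, 0; rewrite big_nil !muln0.
  rewrite big_cons IH /=; case: ifP => Px /=; last first.
    by exists lo, hi; split=> //; rewrite (leq_trans le_lo) // leq_mul2r leqnSn orbT.
  case: (ltngtP (wt x) e) => wx.
  - exists (B ^ wt x + lo), hi; split; first by rewrite addnA.
    by rewrite mulnDl mulSn leq_add // -expnSr leq_pexp2l.
  - exists lo, (B ^ (wt x - e.+1) + hi); split.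
      rewrite -{1}(subnKC wx) expnD expnS; nia.
    by rewrite (leq_trans le_lo) // leq_mul2r leqnSn orbT.
  - exists lo, hi; split; first by rewrite wx; nia.
    by rewrite (leq_trans le_lo) // leq_mul2r leqnSn orbT.
have lo_lt : lo < B ^ e.
  rewrite -(ltn_pmul2r B_gt0) (leq_ltn_trans lo_le) // mulnC ltn_pmul2l //.
  by rewrite expn_gt0 B_gt0.
rewrite eq_sum addnC mulnC divnMDl ?expn_gt0 ?B_gt0 // (divn_small lo_lt) addn0.
by rewrite mulnC addnC modnMDl modn_small // (leq_ltn_trans (count_size _ _)).
Qed.

End Digit.

(** * Generating functions of families of sets *)

Section Families.

Variable T : finType.
Implicit Types (X U : {set T}) (s : seq {set T}).
Variables (ds : nat -> seq {set T}) (w : {set T} -> nat) (B p ks : nat).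

(* Lists of members of [ds q]: of length [l] if [q] is [p], shorter than [l]
   otherwise. *)
Fixpoint fam q l : seq (seq {set T}) :=
  if l is l'.+1 then
    [seq U :: s | U <- ds q, s <- fam q l'] ++ nseq (q != p) [::]
  else nseq (q == p) [::].

Fixpoint fams q : seq (seq {set T}) :=
  if q is q'.+1 then [seq s1 ++ s2 | s1 <- fam q' ks, s2 <- fams q'] else [:: [::]].

Definition weight X s := \prod_(U <- s) ((U \subset X) * B ^ w U).
Definition factor q X := \sum_(U <- ds q) (U \subset X) * B ^ w U.

(* [geom F true l = F ^ l] and [geom F false l = \sum_(i < l) F ^ i]. *)
Fixpoint geom (F : nat) (b : bool) l :=
  if l is l'.+1 then F * geom F b l' + ~~ b else b : nat.

Definition prodP X q := \prod_(i < q) geom (factor i X) (i == p :> nat) ks.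

Lemma sum_fam q l X : \sum_(s <- fam q l) weight X s = geom (factor q X) (q == p) l.
Proof.
have nseq1 (b : bool) : \sum_(s <- nseq b [::]) weight X s = b.
  by case: b; rewrite /= ?big_nil // big_seq1 /weight big_nil.
elim: l => [|l IH] /=; first exact: nseq1.
rewrite big_cat /= nseq1 big_allpairs_dep -IH; congr (_ + _).
rewrite big_distrl /=; apply: eq_bigr => U _; rewrite big_distrr /=.
by apply: eq_bigr => s _; rewrite /weight big_cons.
Qed.

Lemma sum_fams q X : \sum_(s <- fams q) weight X s = prodP X q.
Proof.
elim: q => [|q IH] /=; first by rewrite big_seq1 /weight /prodP big_nil big_ord0.
rewrite /prodP big_ord_recr /= big_allpairs_dep -sum_fam -/(prodP X q) -IH mulnC.
rewrite big_distrl /=; apply: eq_bigr => s1 _; rewrite big_distrr /=.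
by apply: eq_bigr => s2 _; rewrite /weight big_cat.
Qed.

Definition cov s := \bigcup_(U <- s) U.

Lemma weightE X s : weight X s = (cov s \subset X) * B ^ \sum_(U <- s) w U.
Proof.
rewrite /weight /cov; elim: s => [|U s IH]; first by rewrite !big_nil sub0set.
rewrite !big_cons IH subUset expnD.
by case: (U \subset X); case: (_ \subset X); rewrite ?mul1n ?muln0.
Qed.

Definition alt_sum c q := \sum_(X : {set T} | odd #|X| == c) prodP X q.

(* With truncated subtraction the left-hand side is the distance between the two
   sums; only one of its two terms is nonzero. *)
Lemma alt_sumE q :
  (alt_sum false q - alt_sum true q) + (alt_sum true q - alt_sum false q)
  = \sum_(s <- fams q | cov s == setT) B ^ \sum_(U <- s) w U.
Proof.
have aE c : alt_sum c q = \sum_(s <- fams q) supersets_of_parity c (cov s) * B ^ \sum_(U <- s) w U.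
  rewrite /alt_sum (eq_bigr (fun X => \sum_(s <- fams q) weight X s)) => [|X _]; last first.
    by rewrite sum_fams.
  rewrite exchange_big /=; apply: eq_bigr => s _; rewrite big_distrl /=.
  by apply: eq_bigr => X _; rewrite weightE.
(* Lists that do not cover contribute equally to both parities and cancel; a covering list is
   counted only for the full set, hence only in the parity of [#|T|]. *)
have {}aE c : alt_sum c q =
  \sum_(s <- fams q | cov s != setT) supersets_of_parity true (cov s) * B ^ (\sum_(U <- s) w U)
  + (odd #|T| == c) * \sum_(s <- fams q | cov s == setT) B ^ \sum_(U <- s) w U.
  rewrite aE (bigID (fun s => cov s == setT)) /= addnC; congr (_ + _).
    by apply: eq_bigr => s cs; case: c; rewrite // supersets_parityN.
  by rewrite big_distrr /=; apply: eq_bigr => s /eqP->; rewrite supersets_parityT.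
by rewrite !aE !subnDl; case: odd; rewrite ?mul1n ?mul0n ?subn0 ?addn0.
Qed.

Lemma fam_mem q l s :
  (s \in fam q l) = all (mem (ds q)) s && (if q == p then size s == l else size s < l).
Proof.
elim: l s => [|l IH] s /=.
  by rewrite mem_nseq; case: eqP => _; rewrite ?andbF //=; case: s => //= *; rewrite ?andbF.
rewrite mem_cat mem_nseq; apply/orP/idP => [[/allpairsP[[U s'] /= [dU]]|] | ].
- by rewrite IH => /andP[ds_s lt] ->; rewrite /= dU ds_s /=; case: ifP lt.
- by case: (q == p) => //= /eqP->.
case: s => [|U s] /=; first by case: (q == p) => //= _; right.
move=> /andP[/andP[dU ds_s] sz]; left; apply/allpairsP; exists (U, s); split=> //=.
by rewrite IH ds_s; case: ifP sz.
Qed.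

(** The extra bit per stage pays for the possible additional empty list. *)
Lemma size_fam M q l : size (ds q) <= 2 ^ M -> size (fam q l) <= 2 ^ (M.+1 * l).
Proof.
move=> szd; elim: l => [|l IH] /=; first by rewrite muln0 size_nseq; case: (q == p).
rewrite size_cat size_allpairs size_nseq mulnS expnD.
have : size (ds q) * size (fam q l) <= 2 ^ M * 2 ^ (M.+1 * l) by apply: leq_mul.
have : 0 < 2 ^ M * 2 ^ (M.+1 * l) by rewrite muln_gt0 !expn_gt0.
by rewrite expnS -mulnA; case: (q == p) => /=; lia.
Qed.

Lemma size_fams M q : (forall q, size (ds q) <= 2 ^ M) -> size (fams q) <= 2 ^ (M.+1 * ks * q).
Proof.
move=> szd; elim: q => [|q IH] /=; first by rewrite muln0.
rewrite size_allpairs mulnS expnD.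
by rewrite leq_mul ?size_fam.
Qed.

End Families.

(** * Families of districts and partitions *)

(** Each discarded repetition lowers the length by one and the sum by at least one. This serves to
    exclude repeated districts. *)
Lemma sum_undup_leq (T : eqType) (F : T -> nat) (s : seq T) :
    {in s, forall x, 0 < F x} ->
  \sum_(x <- undup s) F x + size s <= \sum_(x <- s) F x + size (undup s).
Proof.
elim: s => [|x s IH] F_gt0; first by rewrite !big_nil.
have {}IH := IH (fun y ys => F_gt0 y (mem_behead (s := x :: s) ys)).
have Fx := F_gt0 x (mem_head x s).
by rewrite big_cons /=; case: ifP => _; rewrite ?big_cons /=; lia.
Qed.

Section Partitions.

Variables (I : instance) (eta : {set 'I_(nv I)} -> 'I_(nc I)).
Implicit Types (s : seq {set 'I_(nv I)}) (U : {set 'I_(nv I)}).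

Definition won_by q : seq {set 'I_(nv I)} :=
  enum [set U | district U && (eta U == q :> nat)].

Definition candidate_fams j := fams won_by (target I) (kstar I) j.

Lemma mem_won_by q U : (U \in won_by q) = district U && (eta U == q :> nat).
Proof. by rewrite mem_enum inE. Qed.

Lemma size_won_by q : size (won_by q) <= 2 ^ nv I.
Proof.
rewrite -cardE (leq_trans (max_card _)) //.
by rewrite -[#|_|]cardsT -powersetT card_powerset cardsT card_ord.
Qed.

Lemma candidate_famsP j s : s \in candidate_fams j ->
  [/\ {in s, forall U, district U /\ eta U < j}, size s <= j * kstar I &
      forall q, q < j -> if q == target I then count (fun U => eta U == q :> nat) s = kstar I
                         else count (fun U => eta U == q :> nat) s < kstar I].
Proof.
elim: j s => [|j IH] s /=; first by rewrite inE => /eqP->.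
case/allpairsP=> [[s1 s2] /= [s1P /IH[s2P sz2 cnt2] ->]].
move: s1P; rewrite fam_mem => /andP[/allP ds1 sz1].
have {}ds1 U : U \in s1 -> district U /\ eta U = j :> nat.
  by move/ds1; rewrite inE mem_won_by => /andP[? /eqP].
have le1 : size s1 <= kstar I by case: ifP sz1 => _; [move/eqP-> | exact: ltnW].
split.
- move=> U; rewrite mem_cat => /orP[/ds1[? ->] | /s2P[? /ltnW]]; by split.
- by rewrite size_cat mulSn leq_add.
move=> q; rewrite ltnS leq_eqVlt count_cat => /orP[/eqP-> | ltq].
  have -> : count (fun U => eta U == j :> nat) s1 = size s1.
    by apply/eqP; rewrite -all_count; apply/allP=> U /ds1[_ ->]; rewrite eqxx.
  have -> : count (fun U => eta U == j :> nat) s2 = 0.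
    apply/eqP; rewrite -leqn0 leqNgt -has_count; apply/hasPn=> U /s2P[_].
    by apply: contraTneq => ->; rewrite ltnn.
  by rewrite addn0; case: ifP sz1 => // _ /eqP.
have -> : count (fun U => eta U == q :> nat) s1 = 0; last exact: cnt2.
apply/eqP; rewrite -leqn0 leqNgt -has_count; apply/hasPn=> U /ds1[_ ->].
by rewrite gtn_eqF.
Qed.

(** The list is obtained by grouping the members of [P] by winner and concatenating the groups in
    the order in which [fams] combines candidates. *)
Lemma candidate_fams_exists (P : {set {set 'I_(nv I)}}) j : j <= nc I ->
    {in P, forall U, district U} ->
    (forall q : 'I_(nc I), if q == target I then wins eta P q = kstar I
                           else wins eta P q < kstar I) ->
  exists2 s, s \in candidate_fams j & perm_eq s (enum [set U in P | eta U < j]).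
Proof.
move=> + dP wP; elim: j => [|j IH] ltj.
  exists [::]; rewrite ?inE // (_ : [set U in P | _] = set0) ?enum_set0 //.
  by apply/setP=> U; rewrite !inE andbF.
have [s sj es] := IH (ltnW ltj).
exists (enum [set U in P | eta U == j :> nat] ++ s).
  apply/allpairsP; exists (enum [set U in P | eta U == j :> nat], s); split=> //=.
  rewrite fam_mem; apply/andP; split.
    apply/allP=> U; rewrite mem_enum inE => /andP[PU eU].
    by rewrite inE mem_won_by dP.
  rewrite -cardE; have := wP (Ordinal ltj).
  rewrite /wins -val_eqE /=.
  rewrite (_ : [set U in P | eta U == Ordinal ltj] = [set U in P | eta U == j :> nat]) //.
  by case: ifP => // _ ->.
apply: uniq_perm.
- rewrite cat_uniq enum_uniq (perm_uniq es) enum_uniq andbT /=.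
  apply/hasPn=> U; rewrite (perm_mem es) !mem_enum !inE => /andP[-> lt].
  by rewrite /= neq_ltn lt.
- exact: enum_uniq.
move=> U; rewrite mem_cat (perm_mem es) !mem_enum !inE ltnS [in RHS]leq_eqVlt.
by case: (U \in P).
Qed.

(** As [D] exceeds both the length of a list and [k], the single number encodes length and total
    size separately. Nonempty sets of total size [n] that cover [n] vertices can neither repeat nor
    overlap. *)
Lemma target_WGM_fams D : nc I * kstar I < D -> kdist I < D ->
  target_WGM eta = has (fun s => (cov s == setT) &&
      (\sum_(U <- s) (1 + D * #|U|) == kdist I + nv I * D)) (candidate_fams (nc I)).
Proof.
move=> ltD kD.
have sumE s : \sum_(U <- s) (1 + D * #|U|) = size s + (\sum_(U <- s) #|U|) * D.
  by rewrite big_split /= sum1_size -big_distrr mulnC.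
apply/existsP/hasP => [[P /and5P[partP /eqP cP /forall_inP dP /eqP wp /forallP wq]] | ].
  have [|s s_fam es] := @candidate_fams_exists P (nc I) (leqnn _) dP.
    move=> q; case: eqP => [-> // | /eqP qp].
    by have /implyP/(_ qp) := wq q; have := kstar_gt0 I; lia.
  have eP : [set U in P | eta U < nc I] = P.
    by apply/setP=> U; rewrite inE ltn_ord andbT.
  rewrite {}eP in es.
  exists s => //; rewrite sumE /cov !(perm_big _ es) /= (perm_size es) -cardE cP !big_enum /=.
  rewrite -/(cover P) (cover_partition partP) eqxx -(card_partition partP) cardsT.
  by rewrite card_ord eqxx.
case=> s s_fam /andP[/eqP cs]; rewrite sumE => /eqP e.
have [s_dist sz cnt] := candidate_famsP s_fam.
have ek : size s = kdist I.
  (* Reduction modulo [D] isolates the number of districts. *)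
  have := congr1 (modn^~ D) e; rewrite /= ![_ + _ * D]addnC !modnMDl.
  by rewrite !modn_small // (leq_ltn_trans sz).
have en : \sum_(U <- s) #|U| = nv I.
  move/eqP: e; rewrite ek eqn_add2l eqn_pmul2r => [/eqP // |].
  exact: leq_trans kD.
pose P := [set U in s].
have covP : cover P = setT.
  rewrite -cs /cover /cov [LHS](eq_bigl (mem s)) => [|U]; last by rewrite inE.
  by rewrite bigcup_seq.
have sub_uniq (F : {set 'I_(nv I)} -> nat) : uniq s -> \sum_(U <- s) F U = \sum_(U in P) F U.
  by move=> us; rewrite big_uniq //=; apply: eq_bigl => U; rewrite inE.
have us : uniq s.
  (* Removing repetitions preserves the union, so the remaining sizes still add up to at least [n],
     the original total; hence nothing was removed. *)
  rewrite -[uniq s]negbK -ltn_size_undup -leqNgt.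
  have := @sum_undup_leq _ (fun U : {set 'I_(nv I)} => #|U|) s; rewrite en => undup_le.
  have {undup_le} : \sum_(U <- undup s) #|U| + size s <= nv I + size (undup s).
    by apply: undup_le => U /s_dist[/districtP[U0 _] _]; rewrite card_gt0.
  have : nv I <= \sum_(U <- undup s) #|U|.
    rewrite -[leqLHS]card_ord -cardsT -covP (leq_trans (leq_card_cover P)) //.
    rewrite (big_uniq _ (undup_uniq s)) /=; apply/eq_leq/eq_bigl => U.
    by rewrite mem_undup inE.
  lia.
have cntE (a : pred {set 'I_(nv I)}) : #|[set U in P | a U]| = count a s.
  rewrite -sum1_card -sum1_count big_mkcond /= [RHS]big_mkcond sub_uniq // [RHS]big_mkcond /=.
  by apply: eq_bigr => U _; rewrite inE; case: (U \in P); case: (a U).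
exists P; apply/and5P; split.
- apply/and3P; split; first by rewrite covP.
    (* Disjointness is the equality case of the union bound. *)
    by rewrite -(leq_card_cover P) covP cardsT card_ord -[eqbLHS]en sub_uniq //.
  by rewrite inE; apply/negP=> /s_dist[/districtP[/eqP]].
- by rewrite -ek cardsE (card_uniqP us).
- by apply/forall_inP=> U; rewrite inE => /s_dist[].
- by have := cnt _ (ltn_ord (target I)); rewrite eqxx /wins cntE => /eqP.
apply/forallP=> q; apply/implyP=> /negPf qp.
have := cnt _ (ltn_ord q); rewrite (_ : (q == target I :> nat) = false) //.
by rewrite /wins cntE; case: (kstar I).
Qed.

End Partitions.

(** * The algorithm and the contents of its tables *)

Lemma nth_allpairs_grid (S T R : Type) (f : S -> T -> R) x0 y0 z0 (s : seq S) (t : seq T) i j :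
  i < size s -> j < size t ->
  nth z0 [seq f x y | x <- s, y <- t] (i * size t + j) = f (nth x0 s i) (nth y0 t j).
Proof.
elim: s i => //= x s IH [|i] lti ltj; rewrite nth_cat size_map.
  by rewrite mul0n ltj (nth_map y0).
by rewrite mulSn -addnA ltnNge leq_addr addKn IH.
Qed.

Section Encoding.

Variable I : instance.

Lemma nth_encode_adj (u v : 'I_(nv I)) : nth 0 (encode I) (5 + (u * nv I + v)) = adj u v.
Proof.
rewrite -[LHS]/(nth 0 (_ ++ _) (u * nv I + v)) nth_cat size_allpairs !size_enum_ord.
have -> : u * nv I + v < nv I * nv I.
  by have := ltn_ord u; have := ltn_ord v; move: (u : nat) (v : nat); nia.
have := @nth_allpairs_grid _ _ _ (fun u v : 'I_(nv I) => nat_of_bool (adj u v)) u v 0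
  (enum 'I_(nv I)) (enum 'I_(nv I)) u v.
by rewrite size_enum_ord !nth_ord_enum => ->.
Qed.

Lemma leq_bitlen_size x : bitlen (nth 0 (encode I) x) <= instance_size I.
Proof.
rewrite /instance_size; case: (ltnP x (size (encode I))) => [|le_x]; last first.
  by rewrite nth_default //= addnC addnS.
elim: (encode I) x => [|y s IH] [|x] //=; first by rewrite leq_addr.
by move=> lt_x; rewrite (leq_trans (IH x lt_x)) ?leq_addl.
Qed.

Lemma leq_size_encode : 5 + nv I * nv I + nv I * nc I <= instance_size I.
Proof.
have -> : 5 + nv I * nv I + nv I * nc I = size (encode I).
  by rewrite /encode !size_cat !size_allpairs !size_enum_ord /= addnA.
rewrite /instance_size; elim: (encode I) => //= x s IH.
by rewrite -add1n leq_add.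
Qed.

End Encoding.

Definition ediv := Bin Div.
Definition emul := Bin Mul.
Definition eadd := Bin Add.
Definition esub := Bin Defs.Sub.
Definition emod x y := esub x (emul (ediv x y) y).
(** Truncated subtraction turns this into a zero test, from which the other tests are built; the
    machine has no comparison. *)
Definition enot x := esub (Const 1) x.
Definition epos x := enot (enot x).
Definition eeq x y := enot (eadd (esub x y) (esub y x)).
Definition tab t e := Cell (addr t e).

Section EvalMacros.

Variables (inp : seq nat) (orc : nat -> nat) (s : memory).
Local Notation ev := (eval inp orc s).

Lemma ev_const x : ev (Const x) = x. Proof. by []. Qed.
Lemma ev_input e : ev (Input e) = nth 0 inp (ev e). Proof. by []. Qed.
Lemma ev_query e : ev (Query e) = orc (ev e). Proof. by []. Qed.
Lemma ev_add x y : ev (eadd x y) = ev x + ev y. Proof. by []. Qed.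
Lemma ev_mul x y : ev (emul x y) = ev x * ev y. Proof. by []. Qed.
Lemma ev_sub x y : ev (esub x y) = ev x - ev y. Proof. by []. Qed.
Lemma ev_div x y : ev (ediv x y) = ev x %/ ev y. Proof. by []. Qed.
Lemma ev_tab t e : ev (tab t e) = s (8 * ev e + t). Proof. by []. Qed.
Lemma ev_counter : ev counter = s 8. Proof. by []. Qed.

Lemma ev_mod x y : ev (emod x y) = ev x %% ev y.
Proof. by rewrite ev_sub ev_mul ev_div {1}(divn_eq (ev x) (ev y)) addKn. Qed.

Lemma ev_not x : ev (enot x) = (ev x == 0).
Proof. by rewrite ev_sub ev_const; case: (ev x). Qed.

Lemma ev_pos x : ev (epos x) = (0 < ev x).
Proof. by rewrite !ev_not; case: (ev x). Qed.

Lemma ev_eq x y : ev (eeq x y) = (ev x == ev y).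
Proof. by rewrite ev_not ev_add !ev_sub addn_eq0 !subn_eq0 eqn_leq. Qed.

Definition evE := (ev_mod, ev_pos, ev_eq, ev_not, ev_add, ev_mul, ev_sub, ev_div,
  ev_tab, ev_counter, ev_query).

End EvalMacros.

Definition e_n := Input (Const 0).
Definition e_m := Input (Const 1).
Definition e_p := Input (Const 2).
Definition e_k := Input (Const 3).
Definition e_ks := Input (Const 4).
Definition e_N := tab 1 e_n.
Definition e_b := eadd (emul (emul (eadd e_n (Const 1)) e_ks) e_m) (Const 1).
Definition e_D := eadd (eadd (emul e_m e_ks) e_k) (Const 1).
Definition e_Q := eadd (emul e_n e_n) (Const 1).
Definition e_bit x j := emod (ediv x (tab 1 j)) (Const 2).

Definition e_len1 :=
  eadd (emul e_b (eadd (eadd e_k (Const 1)) (emul e_D e_n))) (Const 1).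
(** Here and below, cases are distinguished by summing products with complementary 0-1 factors. All
    branches are evaluated, and a meaningless lookup in the wrong branch is multiplied by 0. *)
Definition e_val1 :=
  eadd (enot counter) (emul (epos counter) (emul (Const 2) (tab 1 (esub counter (Const 1))))).

Definition e_len2 := e_N.
Definition e_val2 :=
  emul (epos counter) (eadd (tab 2 (ediv counter (Const 2))) (emod counter (Const 2))).

Definition e_len3 := emul e_N e_Q.
(** For [r > 0], the number [r'] codes the pair [(u, v)] added last. Column [n * n] of a row holds
    the completed sum, so its positivity tests whether [X] without [v] is a district. *)
Definition e_val3 :=
  let X := ediv counter e_Q in
  let r := emod counter e_Q in
  let r' := esub r (Const 1) in
  let u := ediv r' e_n in
  let v := emod r' e_n in
  eadd (emul (enot r) (eeq (tab 2 X) (Const 1)))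
    (emul (epos r)
       (eadd (tab 3 (esub counter (Const 1)))
          (emul (emul (emul (e_bit X u) (e_bit X v)) (Input (eadd (Const 5) r')))
             (epos (tab 3 (eadd (emul (esub X (tab 1 v)) e_Q) (emul e_n e_n))))))).

Definition e_len4 := emul (emul (eadd e_n (Const 1)) e_m) e_N.
(** Step 0 holds the weights of the districts won by [q]. One step of the transform earlier lies
    [m * N] entries back, and deleting vertex [i'] moves back another [2 ^ i']. *)
Definition e_val4 :=
  let X := emod counter e_N in
  let q := emod (ediv counter e_N) e_m in
  let i := ediv (ediv counter e_N) e_m in
  let i' := esub i (Const 1) in
  let prev := esub counter (emul e_m e_N) in
  eadd (emul (enot i)
          (emul (emul (epos (tab 3 (eadd (emul X e_Q) (emul e_n e_n)))) (eeq (Query X) q))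
             (tab 1 (emul e_b (eadd (Const 1) (emul e_D (tab 2 X)))))))
    (emul (epos i)
       (eadd (tab 4 prev) (emul (e_bit X i') (tab 4 (esub prev (tab 1 i')))))).

Definition e_len5 := emul (emul e_N e_m) (eadd e_ks (Const 1)).
(** Horner's rule; the factor is read from layer [n] of table 4, where the zeta transform is
    complete. *)
Definition e_val5 :=
  let l := emod counter (eadd e_ks (Const 1)) in
  let X := ediv (ediv counter (eadd e_ks (Const 1))) e_m in
  let q := emod (ediv counter (eadd e_ks (Const 1))) e_m in
  eadd (emul (enot l) (eeq q e_p))
    (emul (epos l)
       (eadd (emul (tab 4 (eadd (emul (eadd (emul e_n e_m) q) e_N) X))
                (tab 5 (esub counter (Const 1))))
          (enot (eeq q e_p)))).

Definition e_len6 := emul e_N (eadd e_m (Const 1)).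
Definition e_val6 :=
  let X := ediv counter (eadd e_m (Const 1)) in
  let q := emod counter (eadd e_m (Const 1)) in
  eadd (enot q)
    (emul (epos q)
       (emul (tab 6 (esub counter (Const 1)))
          (tab 5 (eadd (emul (eadd (emul X e_m) (esub q (Const 1))) (eadd e_ks (Const 1)))
                    e_ks)))).

Definition e_len7 := eadd (emul (Const 2) e_N) (Const 2).
(** The even and odd running sums are interleaved, so the previous sum of the same parity is two
    entries back; entries 0 and 1 are empty sums. *)
Definition e_val7 :=
  let X := ediv (esub counter (Const 2)) (Const 2) in
  emul (epos (esub counter (Const 1)))
    (eadd (tab 7 (esub counter (Const 2)))
       (emul (eeq (emod (tab 2 X) (Const 2)) (emod counter (Const 2)))
          (tab 6 (eadd (emul X (eadd e_m (Const 1))) e_m)))).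

Definition e_answer :=
  let even := tab 7 (emul (Const 2) e_N) in
  let odd := tab 7 (eadd (emul (Const 2) e_N) (Const 1)) in
  epos (emod (ediv (eadd (esub even odd) (esub odd even))
                (tab 1 (emul e_b (eadd e_k (emul e_n e_D)))))
          (tab 1 e_b)).

(** The counts are written in binary and may be exponential in the instance size, while table
    lengths grow linearly with them. The guard bounds both by [n]; if it fails, the answer is no, as
    cell 0 already says. *)
Definition e_guard := emul (enot (esub e_k e_n)) (enot (esub e_ks e_k)).

Definition fills :=
  Seq (fill 1 e_len1 e_val1) (Seq (fill 2 e_len2 e_val2) (Seq (fill 3 e_len3 e_val3)
  (Seq (fill 4 e_len4 e_val4) (Seq (fill 5 e_len5 e_val5) (Seq (fill 6 e_len6 e_val6)
  (fill 7 e_len7 e_val7)))))).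

Definition algorithm :=
  If e_guard (Seq fills (Store (Const 0) e_answer)) Skip.

(** * Table contents as mathematical functions *)

Section Tables.

Variables (I : instance) (eta : {set 'I_(nv I)} -> 'I_(nc I)).
Local Notation n := (nv I).
Local Notation m := (nc I).
Local Notation k := (kdist I).
Local Notation ks := (kstar I).
Local Notation p := (target I).
Local Notation sm := (set_of_mask n).
Implicit Types (U S : {set 'I_n}).

(* There are fewer than [2 ^ base_bits] families in [candidate_fams], each with
   fewer than [shift] members. *)
Definition base_bits := (n + 1) * ks * m + 1.
Definition shift := m * ks + k + 1.
Definition row_size := n * n + 1.

Local Notation b := base_bits.
Local Notation D := shift.
Local Notation Q := row_size.
Local Notation N := (2 ^ n).

Definition set_weight U := 1 + D * #|U|.

Definition pair_ok S r := [exists u : 'I_n, exists v : 'I_n,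
  (r == u * n + v) && [&& u \in S, v \in S, adj u v & district (S :\ v)]].

(* Detects connectivity because a connected set with more than one vertex has a
   vertex whose deletion leaves it connected. *)
Definition conn_sum S r := (#|S| == 1) + \sum_(i < r) pair_ok S i.

Definition zeta j q S :=
  \sum_(U | agree_from j U S) (U \in won_by eta q) * (2 ^ b) ^ set_weight U.

Definition candidate_factor q S := factor (won_by eta) set_weight (2 ^ b) q S.
Definition candidate_prod S q := prodP (won_by eta) set_weight (2 ^ b) p ks S q.

Definition table_len t :=
  match t with
  | 1 => b * (k + 1 + D * n) + 1
  | 2 => N
  | 3 => N * Q
  | 4 => (n + 1) * m * N
  | 5 => N * m * (ks + 1)
  | 6 => N * (m + 1)
  | _ => 2 * N + 2
  end.

(* Indices pack, in this order, X and a pair of vertices in table 3; the step of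
   the zeta transform, the candidate and X in table 4; X, the candidate and the
   Horner step in table 5; X and the number of candidates in table 6; the number
   of X summed so far and the parity of |X| in table 7. *)
Definition table_spec t i :=
  match t with
  | 1 => 2 ^ i
  | 2 => #|sm i|
  | 3 => conn_sum (sm (i %/ Q)) (i %% Q)
  | 4 => zeta (i %/ N %/ m) (i %/ N %% m) (sm (i %% N))
  | 5 => geom (candidate_factor (i %/ (ks + 1) %% m) (sm (i %/ (ks + 1) %/ m)))
           (i %/ (ks + 1) %% m == p) (i %% (ks + 1))
  | 6 => candidate_prod (sm (i %/ (m + 1))) (i %% (m + 1))
  | _ => \sum_(X < i %/ 2) (odd #|sm X| == odd i) * candidate_prod (sm X) m
  end.

Lemma pair_okE S (u v : 'I_n) :
  pair_ok S (u * n + v) = [&& u \in S, v \in S, adj u v & district (S :\ v)].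
Proof.
apply/existsP/idP => [[u' /existsP[v' /andP[/eqP e uv_ok]]] | uv_ok]; last first.
  by exists u; apply/existsP; exists v; rewrite eqxx.
have n_gt0 : 0 < n by apply: leq_ltn_trans (ltn_ord u).
have eu : u = u'.
  apply: val_inj; have := congr1 (divn^~ n) e.
  by rewrite /= !divnMDl // !divn_small ?addn0.
have ev : v = v'.
  by apply: val_inj; have := congr1 (modn^~ n) e; rewrite /= !modnMDl !modn_small.
by rewrite eu ev.
Qed.

Lemma conn_sum_gt0 S : (0 < conn_sum S (n * n)) = district S.
Proof.
rewrite district_recE addn_gt0 lt0b; congr (_ || _).
rewrite lt0n sum_nat_eq0 negb_forall; apply/existsP/existsP => [[i] | [u /existsP[v uv_ok]]].
  rewrite implyTb -lt0n lt0b => /existsP[u /existsP[v /andP[_ uv_ok]]].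
  by exists u; apply/existsP; exists v.
have lt : u * n + v < n * n.
  by have := ltn_ord u; have := ltn_ord v; move: (u : nat) (v : nat); nia.
by exists (Ordinal lt); rewrite /= pair_okE uv_ok.
Qed.

Lemma zeta0 q S : zeta 0 q S = (district S && (eta S == q :> nat)) * (2 ^ b) ^ set_weight S.
Proof.
rewrite /zeta (eq_bigl (fun U => U == S)) => [|U]; last exact: agree_from0.
by rewrite big_pred1_eq mem_won_by.
Qed.

Lemma zetaS (j : 'I_n) q S :
  zeta j.+1 q S = zeta j q S + (j \in S) * zeta j q (S :\ j).
Proof. exact: zeta_step. Qed.

Lemma zeta_full q S : zeta n q S = candidate_factor q S.
Proof.
rewrite /zeta /candidate_factor /factor [LHS](eq_bigl (fun U => U \subset S)) => [|U]; last exact: agree_from_full.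
rewrite (big_uniq _ (enum_uniq _)) big_mkcond [RHS]big_mkcond /=; apply: eq_bigr => U _.
by rewrite -/(won_by eta q); case: (_ \subset _); case: (_ \in _); rewrite ?mul0n ?mul1n.
Qed.

Lemma prodS S q :
  candidate_prod S q.+1 = candidate_prod S q * geom (candidate_factor q S) (q == p) ks.
Proof. by rewrite /candidate_prod /prodP big_ord_recr. Qed.

Lemma answerE : 0 < m ->
  target_WGM eta =
  (0 < ((table_spec 7 (2 * N) - table_spec 7 (2 * N + 1))
       + (table_spec 7 (2 * N + 1) - table_spec 7 (2 * N)))
         %/ 2 ^ (b * (k + n * D)) %% 2 ^ b).
Proof.
move=> m_gt0.
have specE (c : bool) : table_spec 7 (2 * N + c) = alt_sum (won_by eta) set_weight (2 ^ b) p ks c m.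
  rewrite /table_spec (mulnC 2) /alt_sum divnMDl // (_ : c %/ 2 = 0) ?addn0; last by case: c.
  rewrite oddD oddM andbF addFb oddb.
  rewrite (sum_set_of_mask (fun S => (odd #|S| == c) * candidate_prod S m)) [RHS]big_mkcond /=.
  by apply: eq_bigr => S _; case: ifP; rewrite ?mul1n ?mul0n.
have := specE false; rewrite addn0 => ->.
have -> : table_spec 7 (2 * N + 1) = _ := specE true.
(* There are at most [2 ^ ((n + 1) * ks * m)] families, fewer than the base [2 ^ b], so the digit is
   their exact count. *)
rewrite alt_sumE expnM digit_sum; last first.
  rewrite (leq_ltn_trans (size_fams _ _ _ (size_won_by eta))) // ltn_exp2l //.
  by rewrite /base_bits; lia.
rewrite -has_count (@target_WGM_fams _ eta D) /shift; [|lia|lia].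
by apply: eq_has => s; rewrite /set_weight.
Qed.

End Tables.

(** * Evaluation of the table entries *)

Lemma ltn_grid A Q X r : X < A -> r < Q -> X * Q + r < A * Q.
Proof.
by move=> ltX ltr; apply: leq_trans (leq_mul ltX (leqnn Q)); rewrite mulSn addnC ltn_add2r.
Qed.

Section Evaluation.

Variables (I : instance) (eta : {set 'I_(nv I)} -> 'I_(nc I)).
Local Notation n := (nv I).
Local Notation m := (nc I).
Local Notation k := (kdist I).
Local Notation ks := (kstar I).
Local Notation p := (target I).
Local Notation sm := (set_of_mask n).
Local Notation b := (base_bits I).
Local Notation D := (shift I).
Local Notation Q := (row_size I).
Local Notation N := (2 ^ n).

Hypothesis k_le_n : k <= n.

Variables (B : nat) (s : memory).
Local Notation ev := (eval (encode I) (eta_oracle eta) s).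
Local Notation filled j := (tables_hold B (table_len I) (table_spec eta) j s).

Let n_gt0 : 0 < n. Proof. exact: leq_trans (kdist_gt0 I) k_le_n. Qed.
Let m_gt0 : 0 < m. Proof. exact: leq_ltn_trans (ltn_ord p). Qed.
Let N_gt0 : 0 < N. Proof. by rewrite expn_gt0. Qed.
Let D_gt0 : 0 < D. Proof. by rewrite /shift addn1. Qed.
Let b_gt0 : 0 < b. Proof. by rewrite /base_bits addn1. Qed.
Let Q_gt0 : 0 < Q. Proof. by rewrite /row_size addn1. Qed.

Lemma ev_n : ev e_n = n. Proof. by []. Qed.
Lemma ev_m : ev e_m = m. Proof. by []. Qed.
Lemma ev_p : ev e_p = p. Proof. by []. Qed.
Lemma ev_k : ev e_k = k. Proof. by []. Qed.
Lemma ev_ks : ev e_ks = ks. Proof. by []. Qed.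
Lemma ev_b : ev e_b = b. Proof. by []. Qed.
Lemma ev_D : ev e_D = D. Proof. by []. Qed.
Lemma ev_Q : ev e_Q = Q. Proof. by []. Qed.

Definition inpE := (ev_n, ev_m, ev_p, ev_k, ev_ks, ev_b, ev_D, ev_Q).

Lemma read_spec j t i : filled j -> 0 < t <= j -> i < table_len I t ->
  s (8 * i + t) = table_spec eta t i.
Proof. by case=> _; apply. Qed.

(** This range contains every exponent that is looked up: single vertices, [n], [b], the weights of
    sets and the digit position in the answer. *)
Lemma len1_gt i : i <= b * (k + 1 + D * n) -> i < table_len I 1.
Proof. by rewrite /= [ltnRHS]addn1 ltnS. Qed.

Lemma len1_n i : i <= n -> i < table_len I 1.
Proof.
move=> lei; apply: len1_gt; apply: leq_trans lei _.
by rewrite -[n in leqLHS]mul1n leq_mul // -[n in leqLHS]mul1n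
  (leq_trans (leq_mul D_gt0 (leqnn n))) ?leq_addl.
Qed.

Lemma len1_weight (S : {set 'I_n}) : b * (1 + D * #|S|) < table_len I 1.
Proof.
apply: len1_gt; have cS : #|S| <= n by rewrite -[leqRHS]card_ord max_card.
by rewrite leq_mul2l leq_add ?orbT // ?addn1 // leq_mul2l cS orbT.
Qed.

Lemma ev_N j : filled j -> 0 < j -> ev e_N = N.
Proof. by move=> os j0; rewrite ev_tab inpE (read_spec os) // len1_n. Qed.

Lemma read1 j i : filled j -> 0 < j -> i < table_len I 1 -> s (8 * i + 1) = 2 ^ i.
Proof. by move=> os j0 lti; rewrite (read_spec os). Qed.

Lemma val1P a : s 8 = a -> (forall i, i < a -> s (8 * i + 1) = table_spec eta 1 i) ->
  ev e_val1 = table_spec eta 1 a.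
Proof.
move=> sa prev; rewrite /e_val1 !evE sa !ev_const.
case: a {sa} prev => [|a] prev //=.
by rewrite mul1n subn1 /= prev //= expnS.
Qed.

Lemma val2P a : filled 1 -> s 8 = a -> a < table_len I 2 ->
  (forall i, i < a -> s (8 * i + 2) = table_spec eta 2 i) ->
  ev e_val2 = table_spec eta 2 a.
Proof.
move=> os sa lta prev; rewrite /e_val2 !evE sa !ev_const.
have [-> | a_gt0] := posnP a; first by rewrite /table_spec card_set_of_mask0.
by rewrite mul1n prev ?ltn_Pdiv //= -card_set_of_mask.
Qed.

Lemma read2 j X : filled j -> 1 < j -> X < N -> s (8 * X + 2) = #|sm X|.
Proof. by move=> os j1 ltX; rewrite (read_spec os). Qed.

Lemma spec3E X r : r < Q -> table_spec eta 3 (X * Q + r) = conn_sum (sm X) r.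
Proof. by move=> ltr; rewrite /= divnMDl // divn_small // addn0 modnMDl modn_small. Qed.

Lemma conn_sumS (S : {set 'I_n}) r : conn_sum S r.+1 = conn_sum S r + pair_ok S r.
Proof. by rewrite /conn_sum big_ord_recr /= addnA. Qed.

Lemma spec4E i q X : q < m -> X < N -> table_spec eta 4 ((i * m + q) * N + X) = zeta eta i q (sm X).
Proof.
move=> ltq ltX; rewrite /table_spec !divnMDl // (divn_small ltX) addn0 divnMDl //.
by rewrite (divn_small ltq) addn0 !modnMDl !modn_small.
Qed.

Lemma read_district j X : filled j -> 2 < j -> X < N ->
  (0 < s (8 * (X * Q + n * n) + 3)) = district (sm X).
Proof.
move=> os j2 ltX; have ltQ : n * n < Q by rewrite /row_size addn1.
by rewrite (read_spec os) ?spec3E ?conn_sum_gt0 // ltn_grid.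
Qed.

Lemma val3P a : filled 2 -> s 8 = a -> a < table_len I 3 ->
  (forall i, i < a -> s (8 * i + 3) = table_spec eta 3 i) ->
  ev e_val3 = table_spec eta 3 a.
Proof.
move=> os sa lta prev.
have [X [r [ea ltX ltr]]] : exists X r, [/\ a = X * Q + r, X < N & r < Q].
  by exists (a %/ Q), (a %% Q); rewrite -divn_eq ltn_mod ltn_divLR.
have qa : a %/ Q = X by rewrite ea divnMDl // divn_small // addn0.
have ra : a %% Q = r by rewrite ea modnMDl modn_small.
rewrite [in RHS]ea spec3E // /e_val3 !(inpE, evE) ev_input !(inpE, evE) sa qa ra
  !ev_const (read2 os) //.
case: r ltr ra ea => [|r] ltr ra ea.
  by rewrite mul0n addn0 mul1n /conn_sum big_ord0 addn0.
have ltrn : r < n * n by move: ltr; rewrite /row_size addn1 ltnS.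
have [u [v [eu ev er]]] : exists u v : 'I_n, [/\ r %/ n = u, r %% n = v & r = u * n + v].
  have ltu : r %/ n < n by rewrite ltn_divLR.
  have ltv : r %% n < n by rewrite ltn_mod.
  by exists (Ordinal ltu), (Ordinal ltv); split=> //; apply: divn_eq.
rewrite mul0n add0n mul1n [r.+1 - 1]subSS subn0 eu ev.
have pow w : w < n -> s (8 * w + 1) = 2 ^ w by move=> ltw; rewrite (read1 os) ?len1_n // ltnW.
rewrite !pow // !modn2.
have -> : nth 0 (encode I) (5 + r) = adj u v by rewrite -nth_encode_adj -er.
have -> : a - 1 = X * Q + r by rewrite ea addnS subn1.
rewrite prev; last by rewrite ea addnS.
rewrite spec3E ?(ltnW ltr) // conn_sumS; congr (_ + _).
rewrite er pair_okE !inE.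
(* Only if [v] lies in [X] does [X - 2 ^ v] denote the set without [v]; otherwise a zero factor
   masks the lookup. *)
case: (boolP (odd (X %/ 2 ^ u))) => Xu; last by [].
case: (boolP (odd (X %/ 2 ^ v))) => Xv; last by [].
have [le_vX smX] := @set_of_maskD1 n X v ltX (etrans (in_set _ _) Xv).
have lt_v : X - 2 ^ v < X by rewrite ltn_subrL expn_gt0; apply: leq_trans le_vX; rewrite expn_gt0.
have ltQ : n * n < Q by rewrite /row_size addn1.
rewrite prev; last by rewrite ea ltn_addr // ltn_grid.
rewrite spec3E // conn_sum_gt0 smX.
by case: (adj u v); case: (district _).
Qed.

Lemma read_zeta j i q X : filled j -> 3 < j -> i <= n -> q < m -> X < N ->
  s (8 * ((i * m + q) * N + X) + 4) = zeta eta i q (sm X).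
Proof.
move=> os j3 lei ltq ltX; rewrite (read_spec os) //; first exact: spec4E.
by rewrite /table_len ltn_grid // ltn_grid // addn1.
Qed.

Lemma val4P a : filled 3 -> s 8 = a -> a < table_len I 4 ->
  (forall i, i < a -> s (8 * i + 4) = table_spec eta 4 i) ->
  ev e_val4 = table_spec eta 4 a.
Proof.
move=> os sa lta prev.
have [i [q [X [ea lei ltq ltX]]]] : exists i q X,
    [/\ a = (i * m + q) * N + X, i <= n, q < m & X < N].
  exists (a %/ N %/ m), (a %/ N %% m), (a %% N); rewrite !ltn_mod.
  split=> //; first by rewrite -!divn_eq.
  by rewrite -ltnS ltn_divLR // ltn_divLR // -(addn1 n).
have qa : a %/ N = i * m + q by rewrite ea divnMDl // divn_small // addn0.
have ra : a %% N = X by rewrite ea modnMDl modn_small.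
have qq : (i * m + q) %/ m = i by rewrite divnMDl // divn_small // addn0.
have rq : (i * m + q) %% m = q by rewrite modnMDl modn_small.
have eN := ev_N os isT.
rewrite [in RHS]ea spec4E // /e_val4 !(inpE, eN, evE) sa qa ra qq rq !ev_const (read2 os) //.
case: i lei qq rq qa ea => [|i] lei qq rq qa ea.
  rewrite mul0n addn0 mul1n zeta0 (read_district os) // (read1 os) ?len1_weight //.
  rewrite -expnM /eta_oracle.
  by rewrite -mulnb /set_weight.
pose j := Ordinal lei.
rewrite mul0n add0n mul1n [i.+1 - 1]subSS subn0 (read1 os) ?len1_n 1?ltnW // modn2.
have e_prev : a - m * N = (i * m + q) * N + X.
  by rewrite ea mulSn -addnA mulnDl -addnA addKn.
have lt_prev : (i * m + q) * N + X < a.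
  by rewrite ea mulSn ltn_add2r ltn_pmul2r // -addnA -[ltnLHS]add0n ltn_add2r.
rewrite e_prev prev // spec4E // (zetaS eta j) /=; congr (_ + _); rewrite inE.
(* When [i] is in [X], subtracting [2 ^ i] does not borrow, so the index stays in the same block of
   [N] entries. *)
case: (boolP (odd (X %/ 2 ^ i))) => Xi; last by rewrite !mul0n.
have [le_X smX] := @set_of_maskD1 n X j ltX (etrans (in_set _ _) Xi).
rewrite -smX -addnBA // prev; last by rewrite (leq_ltn_trans _ lt_prev) // leq_add2l leq_subr.
by rewrite spec4E // (leq_ltn_trans _ ltX) // leq_subr.
Qed.

Lemma spec5E X q l : q < m -> l < ks + 1 ->
  table_spec eta 5 ((X * m + q) * (ks + 1) + l) = geom (candidate_factor eta q (sm X)) (q == p) l.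
Proof.
move=> ltq ltl; have ks1 : 0 < ks + 1 by rewrite addn1.
rewrite /table_spec !divnMDl // (divn_small ltl) addn0 divnMDl //.
by rewrite (divn_small ltq) addn0 !modnMDl !modn_small.
Qed.

Lemma val5P a : filled 4 -> s 8 = a -> a < table_len I 5 ->
  (forall i, i < a -> s (8 * i + 5) = table_spec eta 5 i) ->
  ev e_val5 = table_spec eta 5 a.
Proof.
move=> os sa lta prev; have ks1 : 0 < ks + 1 by rewrite addn1.
have [X [q [l [ea ltX ltq ltl]]]] : exists X q l,
    [/\ a = (X * m + q) * (ks + 1) + l, X < N, q < m & l < ks + 1].
  exists (a %/ (ks + 1) %/ m), (a %/ (ks + 1) %% m), (a %% (ks + 1)).
  by rewrite !ltn_mod -!divn_eq !ltn_divLR.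
have qa : a %/ (ks + 1) = X * m + q by rewrite ea divnMDl // divn_small // addn0.
have ra : a %% (ks + 1) = l by rewrite ea modnMDl modn_small.
have qq : (X * m + q) %/ m = X by rewrite divnMDl // divn_small // addn0.
have rq : (X * m + q) %% m = q by rewrite modnMDl modn_small.
have eN := ev_N os isT.
rewrite [in RHS]ea spec5E // /e_val5 !(inpE, eN, evE) sa !ev_const
  qa ra qq rq (read_zeta os) // zeta_full.
case: l ltl ra ea => [|l] ltl ra ea; first by rewrite mul0n addn0 mul1n.
have e_prev : a - 1 = (X * m + q) * (ks + 1) + l.
  by rewrite ea -addnBA // subn1.
rewrite mul0n add0n mul1n e_prev prev; last by rewrite ea ltn_add2l.
rewrite spec5E ?(ltnW ltl) //=.
by case: eqP.
Qed.

Lemma spec6E X q : q < m + 1 -> table_spec eta 6 (X * (m + 1) + q) = candidate_prod eta (sm X) q.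
Proof.
move=> ltq; have m1 : 0 < m + 1 by rewrite addn1.
by rewrite /table_spec divnMDl // (divn_small ltq) addn0 modnMDl modn_small.
Qed.

Lemma val6P a : filled 5 -> s 8 = a -> a < table_len I 6 ->
  (forall i, i < a -> s (8 * i + 6) = table_spec eta 6 i) ->
  ev e_val6 = table_spec eta 6 a.
Proof.
move=> os sa lta prev; have m1 : 0 < m + 1 by rewrite addn1.
have [X [q [ea ltX ltq]]] : exists X q, [/\ a = X * (m + 1) + q, X < N & q < m + 1].
  by exists (a %/ (m + 1)), (a %% (m + 1)); rewrite -divn_eq ltn_mod ltn_divLR.
have qa : a %/ (m + 1) = X by rewrite ea divnMDl // divn_small // addn0.
have ra : a %% (m + 1) = q by rewrite ea modnMDl modn_small.
rewrite [in RHS]ea spec6E // /e_val6 !(inpE, evE) sa !ev_const qa ra.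
case: q ltq ra ea => [|q] ltq ra ea.
  by rewrite mul0n addn0 /candidate_prod /prodP big_ord0.
have ltqm : q < m by move: ltq; rewrite addn1 ltnS.
have e_prev : a - 1 = X * (m + 1) + q by rewrite ea -addnBA // subn1.
rewrite add0n mul1n e_prev prev; last by rewrite ea ltn_add2l.
rewrite spec6E ?(ltnW ltq) //.
rewrite [q.+1 - 1]subSS subn0 (read_spec os) //; last first.
  by rewrite /table_len ltn_grid ?addn1 // ltn_grid.
by rewrite spec5E ?addn1 // prodS.
Qed.

Lemma val7P a : filled 6 -> s 8 = a -> a < table_len I 7 ->
  (forall i, i < a -> s (8 * i + 7) = table_spec eta 7 i) ->
  ev e_val7 = table_spec eta 7 a.
Proof.
move=> os sa lta prev.
rewrite /e_val7 !(inpE, evE) sa !ev_const.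
case: a sa lta prev => [|[|a]] sa lta prev; [by rewrite mul0n /table_spec divn_small ?big_ord0 .. |].
rewrite subn1 mul1n.
have -> : a.+2 - 2 = a by rewrite subn2.
have ltX : a %/ 2 < N by rewrite ltn_divLR //; move: lta; rewrite /table_len; lia.
rewrite prev // (read2 os) // (read_spec os) //; last by rewrite /table_len ltn_grid // addn1.
rewrite spec6E ?addn1 // /table_spec.
have -> : a.+2 %/ 2 = (a %/ 2).+1 by rewrite -addn2 divnDr // addn1.
have -> : odd a.+2 = odd a by rewrite /= negbK.
have -> : a.+2 %% 2 = odd a by rewrite modn2 /= negbK.
by rewrite big_ord_recr /= modn2; case: (odd a); case: (odd _).
Qed.

Lemma answerP : filled 7 -> ev e_answer = target_WGM eta.
Proof.
move=> os; have eN := ev_N os isT.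
rewrite (answerE _ m_gt0) /e_answer !(inpE, eN, evE) !ev_const !(read_spec os) //.
- apply: len1_gt; rewrite -[leqLHS]muln1 leq_mul2l; lia.
- by apply: len1_gt; rewrite leq_mul2l (mulnC n) leq_add2r leq_addr orbT.
- by rewrite /table_len; lia.
- by rewrite /table_len; lia.
Qed.

End Evaluation.

(** * Word sizes and table lengths *)

Section Bounds.

Variables (I : instance) (eta : {set 'I_(nv I)} -> 'I_(nc I)).
Local Notation n := (nv I).
Local Notation m := (nc I).
Local Notation k := (kdist I).
Local Notation ks := (kstar I).
Local Notation sm := (set_of_mask n).
Local Notation b := (base_bits I).
Local Notation D := (shift I).
Local Notation Q := (row_size I).
Local Notation N := (2 ^ n).

(** At most [2 ^ n] sets, each of weight at most [2 ^ (b * (1 + D * n))]. *)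
Definition zeta_bits := n + b * (1 + D * n).
(** Adding up the exponents that bound the entries and lengths of all tables avoids taking a
    maximum. *)
Definition word_bits := instance_size I + (n + table_len I 1 + Q + (n + 1) * m + m * (ks + 1)
  + m * (ks * zeta_bits.+1) + zeta_bits + ks * zeta_bits.+1 + 3).

Local Notation f := zeta_bits.
Local Notation B := word_bits.

Lemma zeta_leq j q S : zeta eta j q S <= 2 ^ f.
Proof.
have card_sets : \sum_(U : {set 'I_n}) 1 = 2 ^ n.
  by rewrite sum1_card -[#|_|]cardsT -powersetT card_powerset cardsT card_ord.
rewrite /zeta_bits expnD -card_sets big_distrl /= /zeta big_mkcond leq_sum // => U _.
case: ifP => // _; rewrite mul1n -expnM; case: (_ \in _); rewrite ?mul1n //.
rewrite leq_pexp2l // leq_mul2l /set_weight leq_add2l leq_mul2l.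
by rewrite -[n in _ <= n]card_ord max_card !orbT.
Qed.

Lemma fac_leq q S : candidate_factor eta q S <= 2 ^ f.
Proof. by rewrite -zeta_full zeta_leq. Qed.

(** The additional bit per Horner step absorbs the added 1. *)
Lemma geom_leq F c l : F <= 2 ^ f -> geom F c l <= 2 ^ (l * f.+1).
Proof.
move=> leF; elim: l => [|l IH] /=; first by case: c.
have le1 : F * geom F c l <= 2 ^ f * 2 ^ (l * f.+1) by rewrite leq_mul.
have : 0 < 2 ^ f * 2 ^ (l * f.+1) by rewrite muln_gt0 !expn_gt0.
have -> : 2 ^ (l.+1 * f.+1) = 2 * (2 ^ f * 2 ^ (l * f.+1)).
  by rewrite mulSn expnD expnS mulnA.
by case: c {IH} le1 => /=; lia.
Qed.

Lemma prod_leq S q : candidate_prod eta S q <= 2 ^ (q * (ks * f.+1)).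
Proof.
elim: q => [|q IH]; first by rewrite /candidate_prod /prodP big_ord0.
by rewrite prodS mulSn addnC expnD leq_mul // geom_leq // fac_leq.
Qed.

Lemma conn_sum_leq (S : {set 'I_n}) r : conn_sum S r <= r.+1.
Proof.
rewrite /conn_sum -(add1n r) leq_add ?leq_b1 // -[r in leqRHS]card_ord -sum1_card.
by apply: leq_sum => i _; apply: leq_b1.
Qed.

Lemma bitlen_pow2 x j : x <= 2 ^ j -> j < B -> bitlen x <= B.
Proof.
by move=> lex ltj; rewrite bitlen_leq ?(leq_ltn_trans lex) ?ltn_exp2l // (leq_trans _ ltj).
Qed.

Lemma spec_bits t i : 0 < t < 8 -> i < table_len I t -> bitlen (table_spec eta t i) <= B.
Proof.
move=> /andP[t0 t8] lti; have le_n (S : {set 'I_n}) : #|S| <= n.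
  by rewrite -[leqRHS]card_ord max_card.
move: t t0 t8 lti; do 8?[case=> //] => _ _ lti.
- by apply: (bitlen_pow2 (leqnn _)); rewrite /word_bits; lia.
- apply: (@bitlen_pow2 _ n); last by rewrite /word_bits; lia.
  by rewrite (leq_trans (le_n _)) // ltnW // ltn_expl.
- apply: (@bitlen_pow2 _ Q); last by rewrite /word_bits; lia.
  rewrite (leq_trans (conn_sum_leq _ _)) // (leq_trans _ (ltn_expl _ (isT : 1 < 2))) //.
  by rewrite ltnS ltnW // ltn_mod /row_size addn1.
- by apply: (bitlen_pow2 (zeta_leq _ _ _)); rewrite /word_bits; lia.
- apply: (@bitlen_pow2 _ (ks * f.+1)); last by rewrite /word_bits; lia.
  rewrite (leq_trans (geom_leq _ _ (fac_leq _ _))) // leq_pexp2l // leq_mul2r.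
  by rewrite -ltnS -(addn1 ks) ltn_mod addn1 orbT.
- apply: (@bitlen_pow2 _ (m * (ks * f.+1))); last by rewrite /word_bits; lia.
  rewrite (leq_trans (prod_leq _ _)) // leq_pexp2l // leq_mul2r.
  by rewrite -ltnS -(addn1 m) ltn_mod addn1 orbT.
apply: (@bitlen_pow2 _ (n + m * (ks * f.+1))); last by rewrite /word_bits; lia.
have lei : i %/ 2 <= 2 ^ n by rewrite -ltnS ltn_divLR //; move: lti; rewrite /table_len; lia.
rewrite expnD (leq_trans _ (leq_mul lei (leqnn _))) //.
rewrite -[X in X * _]card_ord -sum1_card big_distrl /=; apply: leq_sum => X _.
by rewrite leq_mul ?leq_b1 // prod_leq.
Qed.

Lemma len_bits t : 0 < t < 8 -> bitlen (table_len I t) <= B.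
Proof.
move=> /andP[t0 t8].
have pow x : x <= 2 ^ x by rewrite ltnW // ltn_expl.
move: t t0 t8; do 8?[case=> //] => _ _.
- by apply: (bitlen_pow2 (pow _)); rewrite /word_bits; lia.
- by apply: (bitlen_pow2 (leqnn _)); rewrite /word_bits; lia.
- apply: (@bitlen_pow2 _ (n + Q)); last by rewrite /word_bits; lia.
  by rewrite /table_len expnD leq_mul.
- apply: (@bitlen_pow2 _ (n + (n + 1) * m)); last by rewrite /word_bits; lia.
  by rewrite /table_len mulnC expnD leq_mul.
- apply: (@bitlen_pow2 _ (n + m * (ks + 1))); last by rewrite /word_bits; lia.
  by rewrite /table_len -mulnA expnD leq_mul.
- apply: (@bitlen_pow2 _ (n + (n + 1) * m + 1)); last by rewrite /word_bits; lia.
  rewrite /table_len -addnA expnD leq_mul // (leq_trans (pow _)) // leq_pexp2l //; nia.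
apply: (@bitlen_pow2 _ (n + 2)); last by rewrite /word_bits; lia.
by rewrite /table_len expnD; have := expn_gt0 2 n; lia.
Qed.

Lemma input_bits x : bitlen (nth 0 (encode I) x) <= B.
Proof. by rewrite (leq_trans (leq_bitlen_size _ _)) ?leq_addr. Qed.

Lemma oracle_bits_size x : bitlen (eta_oracle eta x) <= instance_size I.
Proof.
apply: leq_trans (leq_bitlen_size I 1).
by apply: leq_bitlen; apply: ltnW; apply: ltn_ord.
Qed.

Lemma oracle_bits x : bitlen (eta_oracle eta x) <= B.
Proof. by rewrite (leq_trans (oracle_bits_size _)) ?leq_addr. Qed.

Lemma word_bits_gt0 : 0 < B.
Proof. by rewrite /word_bits; lia. Qed.

Definition table_total := table_len I 1 + Q + (n + 1) * m + m * (ks + 1) + m + 6.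

Lemma len_total t : 0 < t < 8 -> (table_len I t).+1 <= N * table_total.
Proof.
have N0 : 0 < N by rewrite expn_gt0.
move=> /andP[t0 t8]; move: t t0 t8; do 8?[case=> //] => _ _; rewrite /table_total /table_len;
  move: (N) N0 (row_size I) (base_bits I) (shift I) => N' N0 ? ? ?; nia.
Qed.

End Bounds.

(** * Correctness and running time *)

Definition guard_cost := 4 * esize e_guard ^ 2.

(** The word bound [C] is left free: [word_bits] serves when the guard holds, but it need not be
    polynomial when the guard fails, and then [instance_size] is taken. *)
Lemma guard_leq C inp orc s : 0 < C -> (forall x, bitlen (nth 0 inp x) <= C) ->
    (forall x, bitlen (orc x) <= C) -> bounded C s ->
  cost inp orc s e_guard + bitlen (eval inp orc s e_guard) <= guard_cost * C ^ 2.
Proof.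
move=> C0 inpC orcC bs.
have := cost_leq C0 inpC orcC e_guard bs; have := bitlen_eval C0 inpC orcC e_guard bs.
rewrite /guard_cost; move: (esize _) (cost _ _ _ _) (bitlen _) => z x y; nia.
Qed.

Lemma eval_guard (I : instance) (eta : {set 'I_(nv I)} -> 'I_(nc I)) s :
  eval (encode I) (eta_oracle eta) s e_guard
  = ((kdist I <= nv I) && (kstar I <= kdist I)).
Proof. by rewrite ev_mul !ev_not !ev_sub !subn_eq0 mulnb. Qed.

Section Correctness.

Variables (I : instance) (eta : {set 'I_(nv I)} -> 'I_(nc I)).
Hypothesis k_le_n : kdist I <= nv I.
Local Notation B := (word_bits I).
Local Notation filled j := (tables_hold B (table_len I) (table_spec eta) j).
Local Notation computes := (runs (encode I) (eta_oracle eta)).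

Lemma fill_table t L E : 0 < t < 8 ->
    (forall s, filled t.-1 s -> eval (encode I) (eta_oracle eta) s L = table_len I t) ->
    (forall s a, filled t.-1 s -> s 8 = a -> a < table_len I t ->
       (forall i, i < a -> s (8 * i + t) = table_spec eta t i) ->
       eval (encode I) (eta_oracle eta) s E = table_spec eta t a) ->
  computes (fill t L E) (filled t.-1) (fill_cost t L E * (2 ^ nv I * table_total I * B ^ 2))
    (filled t).
Proof.
move=> t8 HL HE s os.
have [u [s' [ex os' le_u]]] := fillP (word_bits_gt0 I) (input_bits I) (oracle_bits eta)
  t8 HL HE (len_bits _ t8) (fun a => spec_bits eta t8) os.
by exists u, s'; split=> //; rewrite (leq_trans le_u) // -mulnA leq_mul // leq_mul ?len_total.
Qed.

Definition fills_cost :=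
  fill_cost 1 e_len1 e_val1 + (fill_cost 2 e_len2 e_val2 + (fill_cost 3 e_len3 e_val3 +
  (fill_cost 4 e_len4 e_val4 + (fill_cost 5 e_len5 e_val5 + (fill_cost 6 e_len6 e_val6 +
  fill_cost 7 e_len7 e_val7))))).

Lemma fillsP : computes fills (filled 0)
  (fills_cost * (2 ^ nv I * table_total I * B ^ 2)) (filled 7).
Proof.
rewrite /fills_cost.
apply: runs_seqM.
  by apply: fill_table => // s a _ sa _; apply: val1P.
apply: runs_seqM.
  by apply: fill_table => // [s os | s a]; [apply: ev_N os _ | apply: val2P].
apply: runs_seqM.
  apply: fill_table => // [s os | s a]; last exact: val3P.
  by rewrite /e_len3 ev_mul (ev_N os).
apply: runs_seqM.
  apply: fill_table => // [s os | s a]; last exact: val4P.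
  by rewrite /e_len4 ev_mul (ev_N os).
apply: runs_seqM.
  apply: fill_table => // [s os | s a]; last exact: val5P.
  by rewrite /e_len5 !ev_mul (ev_N os).
apply: runs_seqM.
  apply: fill_table => // [s os | s a]; last exact: val6P.
  by rewrite /e_len6 !ev_mul (ev_N os).
apply: fill_table => // [s os | s a]; last exact: val7P.
by rewrite /e_len7 ev_add ev_mul (ev_N os).
Qed.

Lemma solves_guarded : kstar I <= kdist I ->
  solves_within algorithm eta
    ((guard_cost + fills_cost + store_cost (Const 0) e_answer)
      * (2 ^ nv I * table_total I * B ^ 2)).
Proof.
move=> ks_le_k.
have bs0 : bounded B (fun=> 0) by move=> a; apply: word_bits_gt0.
have os0 : filled 0 (fun=> 0) by split=> // -[].
have [t1 [s1 [ex1 os1 le1]]] := fillsP os0.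
have [t2 [ex2 le2]] := exec_store (word_bits_gt0 I) (input_bits I) (oracle_bits eta)
  (Const 0) e_answer os1.1.
have g1 : eval (encode I) (eta_oracle eta) (fun=> 0) e_guard != 0.
  by rewrite eval_guard k_le_n ks_le_k.
eexists _, _; split; first exact: ExecIfT g1 (ExecSeq ex1 ex2).
  by rewrite /update eqxx (answerP k_le_n os1).
have le0 := guard_leq (word_bits_gt0 I) (input_bits I) (oracle_bits eta) bs0.
have B2_le : B ^ 2 <= 2 ^ nv I * table_total I * B ^ 2.
  by rewrite leq_pmull // muln_gt0 expn_gt0 /table_total addnS.
move: guard_cost fills_cost (store_cost _ _) (_ * B ^ 2) B2_le le0 le1 le2 =>
  g c1 c2 T B2_le le0 le1 le2.
rewrite !mulnDl addnA; apply: leq_add; last by rewrite (leq_trans le2) // leq_mul.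
by apply: leq_add => //; rewrite (leq_trans le0) // leq_mul.
Qed.

End Correctness.

(** A partition into [k] nonempty districts needs [k] vertices, and no candidate wins more than [k]
    of them, so these are no-instances. *)
Lemma solves_unguarded (I : instance) (eta : {set 'I_(nv I)} -> 'I_(nc I)) :
    ~~ ((kdist I <= nv I) && (kstar I <= kdist I)) ->
  solves_within algorithm eta ((guard_cost + 1) * instance_size I ^ 2).
Proof.
move=> big; have S_gt0 : 0 < instance_size I by apply: leq_trans (leq_size_encode I).
have g0 : eval (encode I) (eta_oracle eta) (fun=> 0) e_guard = 0.
  by rewrite eval_guard (negPf big).
eexists _, _; split; first exact: (ExecIfF _ g0 (ExecSkip _ _ _)).
  apply/esym/eqP; rewrite eqb0; apply: contra big.
  case/existsP=> P /and5P[partP /eqP cP /forall_inP dP /eqP wp _].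
  rewrite -wp -cP; apply/andP; split; last first.
    by apply: subset_leq_card; apply/subsetP=> U; rewrite inE => /andP[].
  rewrite -[leqRHS]card_ord -cardsT (card_partition partP) -sum1_card.
  by apply: leq_sum => U /dP /districtP[U0 _]; rewrite card_gt0.
have := guard_leq S_gt0 (leq_bitlen_size I) (oracle_bits_size eta) (s := fun=> 0) (fun=> S_gt0).
have : 0 < instance_size I ^ 2 by rewrite expn_gt0 S_gt0.
by rewrite mulnDl mul1n => h1 h2; apply: leq_add.
Qed.

(** * Polynomial bounds in the instance size *)

Definition small_counts (I : instance) := (kdist I <= nv I) && (kstar I <= kdist I).
(** No leading coefficient is needed: the size is at least 2, so constants are absorbed by the
    exponent. *)
Definition polynomial (g : instance -> nat) :=
  exists c, forall I, small_counts I -> g I <= instance_size I ^ c.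

Lemma instance_size_gt1 I : 1 < instance_size I.
Proof. by have := leq_size_encode I; lia. Qed.

Lemma poly_const x : polynomial (fun=> x).
Proof.
exists x => I _; case: x => // x.
by rewrite (leq_trans (ltnW (ltn_expl _ (isT : 1 < 2)))) // leq_exp2r // instance_size_gt1.
Qed.

Lemma poly_mul g h : polynomial g -> polynomial h -> polynomial (fun I => g I * h I).
Proof.
move=> [c gc] [d hd]; exists (c + d) => I sI.
by rewrite expnD leq_mul ?gc ?hd.
Qed.

Lemma poly_add g h : polynomial g -> polynomial h -> polynomial (fun I => g I + h I).
Proof.
move=> [c gc] [d hd]; exists (c + d).+1 => I sI.
have S1 := instance_size_gt1 I; have S0 := ltnW S1.
have gle : g I <= instance_size I ^ (c + d).
  by rewrite (leq_trans (gc I sI)) // leq_pexp2l // leq_addr.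
have hle : h I <= instance_size I ^ (c + d).
  by rewrite (leq_trans (hd I sI)) // leq_pexp2l // leq_addl.
by rewrite expnS (leq_trans (leq_add gle hle)) // addnn -mul2n leq_mul2r S1 orbT.
Qed.

Lemma poly_leq g h : (forall I, small_counts I -> g I <= h I) -> polynomial h -> polynomial g.
Proof. by move=> le_gh [c hc]; exists c => I sI; rewrite (leq_trans (le_gh I sI)) ?hc. Qed.

Lemma poly_exp g c : polynomial g -> polynomial (fun I => g I ^ c).
Proof.
move=> pg; elim: c => [|c IH].
  by apply: poly_leq (poly_const 1) => I _.
by apply: poly_leq (poly_mul pg IH) => I _; rewrite expnS.
Qed.

Lemma poly_succ g : polynomial g -> polynomial (fun I => (g I).+1).
Proof. by move=> pg; apply: poly_leq (poly_add pg (poly_const 1)) => I _; rewrite addn1. Qed.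

Lemma poly_size : polynomial instance_size.
Proof. by exists 1. Qed.

Lemma poly_nv : polynomial nv.
Proof.
apply: poly_leq poly_size => I _; apply: leq_trans (leq_size_encode I).
rewrite -addnA addnCA (leq_trans _ (leq_addr _ _)) //.
by case: (nv I) => // ?; rewrite mulnS leq_addr.
Qed.

(** The guard forces a vertex to exist, and its row of weights has one entry per candidate. *)
Lemma poly_nc : polynomial nc.
Proof.
apply: poly_leq poly_size => I /andP[kn _]; apply: leq_trans (leq_size_encode I).
have n0 : 0 < nv I := leq_trans (kdist_gt0 I) kn.
by rewrite (leq_trans (leq_pmull _ n0)) ?leq_addl.
Qed.

Lemma poly_kdist : polynomial kdist.
Proof. by apply: poly_leq poly_nv => I /andP[]. Qed.

Lemma poly_kstar : polynomial kstar.
Proof. by apply: poly_leq poly_kdist => I /andP[]. Qed.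

Lemma poly_time : polynomial (fun I =>
  (guard_cost + fills_cost + store_cost (Const 0) e_answer) * table_total I * word_bits I ^ 2).
Proof.
move: (guard_cost + _ + _) => C.
rewrite /word_bits /table_total /zeta_bits /row_size /table_len; cbv beta iota; rewrite /base_bits /shift.
repeat first [apply: poly_const | apply: poly_nv | apply: poly_nc | apply: poly_kdist
  | apply: poly_kstar | apply: poly_size | apply: poly_exp | apply: poly_mul
  | apply: poly_add | apply: poly_succ].
Qed.

Theorem theorem8 :
  exists (algo : prog) (c : nat),
    forall (I : instance) (eta : {set 'I_(nv I)} -> 'I_(nc I)),
      tie_breaking_rule eta ->
      solves_within algo eta (2 ^ nv I * instance_size I ^ c).
Proof.
have [c time_c] := poly_time.
(* [c] serves the guarded case and [d + 2] the other one: the size to the power [d] dominates the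
   constant [d], and the square comes from the cost of the guard. *)
pose d := guard_cost + 1; exists algorithm, (c + (d + 2)) => I eta _.
have S1 := instance_size_gt1 I; have S0 := ltnW S1.
have weaken x y : x <= y -> solves_within algorithm eta x -> solves_within algorithm eta y.
  by move=> le_xy [t [s [ex s0 le_t]]]; exists t, s; split=> //; apply: leq_trans le_xy.
case: (boolP (small_counts I)) => sI; last first.
  apply: weaken (solves_unguarded eta sI).
  rewrite -[leqLHS]mul1n leq_mul ?expn_gt0 // expnD -[leqLHS]mul1n leq_mul ?expn_gt0 ?S0 //.
  rewrite expnD leq_mul // (leq_trans (ltnW (ltn_expl d (isT : 1 < 2)))) //.
  by rewrite /d addn1 leq_exp2r.
have /andP[k_le_n ks_le_k] := sI.
apply: weaken (solves_guarded eta k_le_n ks_le_k).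
move: (guard_cost + _ + _) time_c => C time_c.
rewrite -mulnA mulnCA leq_mul // mulnA (leq_trans (time_c I sI)) //.
by rewrite leq_pexp2l // leq_addr.
Qed.
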